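(* Given $\alpha>0$ and a real number $p\ge1$, there exist $\gamma>0$ and a function $f\in L^p(\mathbb R_+)$ such that (a) the Laplace transform $\widehat f$ admits a bounded analytic extension to the region $$\Omega:=\big\{z\in\mathbb C:\operatorname{Re}z>-1/(\log(2+|\operatorname{Im}z|))^\alpha\big\},$$ and (b) $$\int_0^\infty\Big|\widehat f(0)-\int_0^t f(s)\,ds\Big|^p e^{\gamma t^{1/(\alpha+1)}}\,dt=\infty.$$
   Context: $\mathbb R_+=[0,\infty)$; functions in $L^p(\mathbb R_+)$ are complex-valued. $\widehat f(\lambda)=\int_0^\infty e^{-\lambda t}f(t)\,dt$, holomorphic on $\{\operatorname{Re}\lambda>0\}$; the same symbol denotes its holomorphic extension. *)

(* Defs.v *)
From HB Require Import structures.
From mathcomp Require Import all_boot all_order all_algebra.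
From mathcomp Require Import complex.
From mathcomp Require Import all_classical all_reals all_analysis.

Set Implicit Arguments.
Unset Strict Implicit.
Unset Printing Implicit Defensive.

Import Order.TTheory GRing.Theory Num.Theory.
Import numFieldNormedType.Exports.

Local Open Scope classical_set_scope.
Local Open Scope ring_scope.
Local Open Scope complex_scope.

(* Throughout, the complex numbers are [R[i]] for [R : realType], and [Re],
   [Im], [normc] are its R-valued real part, imaginary part and modulus. *)
Notation Re := (@complex.Re _).
Notation Im := (@complex.Im _).
Notation normc := (@complex.ComplexField.Normc.normc _).

Section ComplexFunctions.
Context {R : realType}.
Implicit Types (f : R -> R[i]) (F : R[i] -> R[i]) (z : R[i]) (U : set R[i]).

Local Notation mu := (@lebesgue_measure R).

Definition expC z : R[i] :=
  (expR (Re z) * cos (Im z)) +i* (expR (Re z) * sin (Im z)).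

(* Meaningful when both components are integrable on [D]; this holds by Hoelder
   for f in L^p(R_+) with p >= 1, both over [0, t] and, for Re z > 0, in the
   Laplace integral at z. *)
Definition Cintegral (D : set R) f : R[i] :=
  Rintegral mu D (Re \o f) +i* Rintegral mu D (Im \o f).

Definition half_line : set R := `[0, +oo[.

(* [f] represents an element of L^p(R_+; C); its values on the negative reals
   are irrelevant. *)
Definition Lp_half_line (p : R) f : Prop :=
  [/\ measurable_fun half_line (Re \o f),
      measurable_fun half_line (Im \o f) &
      (\int[mu]_(t in half_line) ((normc (f t)) `^ p)%R%:E < +oo)%E].

Definition laplace f z : R[i] :=
  Cintegral half_line (fun t => expC (- (z * t%:C)) * f t).

(* Complex differentiability: [derivable] is taken over the field [R[i]], so
   the increments of the difference quotient are complex. *)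
Definition holomorphic_on U F : Prop :=
  forall z, U z -> derivable (F : R[i]^o -> R[i]^o) z 1.

Definition bounded_on U F : Prop :=
  exists M : R, forall z, U z -> normc (F z) <= M.

Definition right_half_plane : set R[i] := [set z | 0 < Re z].

Definition log_region (alpha : R) : set R[i] :=
  [set z | - 1 / (ln (2 + `|Im z|) `^ alpha) < Re z].

(* [F] is a bounded analytic extension of the Laplace transform of [f] to [U].
   For [U] open, connected and containing the right half-plane there is at most
   one such [F] on [U]. *)
Definition bounded_analytic_extension f U F : Prop :=
  [/\ holomorphic_on U F,
      bounded_on U F &
      forall z, right_half_plane z -> F z = laplace f z].

End ComplexFunctions.

(* Main.v *)
Require Import Defs.
From mathcomp Require Import all_boot all_order all_algebra.
From mathcomp Require Import complex.
From mathcomp Require Import ring lra zify.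
From mathcomp Require Import all_classical all_reals all_analysis.
From mathcomp Require Import measurable_realfun.
Import Order.TTheory GRing.Theory Num.Theory.
Import numFieldNormedType.Exports.
Set Implicit Arguments.
Unset Strict Implicit.
Unset Printing Implicit Defensive.
Local Open Scope classical_set_scope.
Local Open Scope complex_scope.
Local Open Scope ring_scope.
(* Otherwise these names denote the real and imaginary parts of a closed field
   with conjugation, which are valued in that field. *)
Local Notation Re := (@complex.Re _).
Local Notation Im := (@complex.Im _).

(** The function f is a lacunary superposition of wave packets.  Fix b > 0 with
    - b to the left of the region.  Up to a small amplitude c_n, the n-th packet
    is b^(k+1) t^k / k! * exp (- (b - i w) t) with k = k_n and w = w_n : a bump of
    mass 1 centred at t = k/b, with exponential tails, oscillating at frequency w.
    Its Laplace transform is (b / (z + b - i w))^(k+1).  With x = k^(1/(alpha+1)),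
    put w = exp x and c = exp (- K x).

    The transforms are uniformly bounded on the region ([region_bound]).  Where
    |Im z| <= w/2 the base b / (z + b - i w) has modulus at most 1.  Where
    |Im z| > w/2, the region forces Re z >= - s with s = (2/x)^alpha, so the power
    is at most exp (O(s k)); since x^(alpha+1) = k, the product s k is of order x,
    and this growth is absorbed by c once K is large.

    On the other hand, the tail int_t^oo f near t = k/b sees the n-th packet only
    through its oscillation.  Integration by parts in closed form ([gtail]) shows
    that this packet contributes at least exp (- (K+2) x): the amplitude, one
    factor 1/w = exp (- x) from the oscillation, and a polynomial loss in k
    ([tail_term_ge]).  If the k_n grow geometrically with a large ratio, the
    earlier packets have died out exponentially in k, which dominates x, and the
    later ones have a much smaller amplitude ([tail_ge]).  As t^(1/(alpha+1)) is
    comparable to x there, a large gamma makes the weighted integrand at least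
    exp x on an interval of length 1/b, for every n
    ([weighted_tail_integral]).

    All series are dominated by a multiple of 2^-(n+1).  This gives the
    holomorphy of the sum of the transforms term by term, through quadratic
    Taylor remainders with a summable majorant ([derivable_csum]), and, together
    with dominated convergence for the majorant C / (1 + t^2), the exchange of the
    sum with every integral involved ([Cintegral_csum]). *)

(** * Modulus, exponential and derivatives of complex-valued functions *)

Section ComplexModulus.
Context {R : realType}.
Implicit Types (z w : R[i]) (x t : R).

Lemma normcD z w : normc (z + w) <= normc z + normc w.
Proof. exact: complex.le_normcD. Qed.

Lemma normcN z : normc (- z) = normc z.
Proof. exact: complex.normcN. Qed.

Lemma normcM z w : normc (z * w) = normc z * normc w.
Proof. exact: complex.ComplexField.Normc.normcM. Qed.

Lemma normcV z : normc z^-1 = (normc z)^-1.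
Proof. exact: complex.ComplexField.Normc.normcV. Qed.

Lemma normc0 : normc (0 : R[i]) = 0.
Proof. exact: complex.ComplexField.Normc.normc0. Qed.

Lemma normc_ge0 z : 0 <= normc z.
Proof. by case: z => a b; rewrite sqrtr_ge0. Qed.

Lemma normcX z n : normc (z ^+ n) = normc z ^+ n.
Proof.
elim: n => [|n IH]; first by rewrite !expr0 complex.ComplexField.Normc.normc1.
by rewrite !exprS normcM IH.
Qed.

Lemma normc_real x : normc x%:C = `|x|.
Proof. by rewrite /= expr0n addr0 sqrtr_sqr. Qed.

Lemma normc_gt0 z : z != 0 -> 0 < normc z.
Proof.
move=> z0; rewrite lt_neqAle normc_ge0 andbT eq_sym.
by apply: contra z0 => /eqP/complex.ComplexField.Normc.eq0_normc ->.
Qed.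

Lemma normc_distD z w : normc z - normc w <= normc (z + w).
Proof.
by have := normcD (z + w) (- w); rewrite addrK normcN -lerBlDr.
Qed.

Lemma normr_Re_le z : `|Re z| <= normc z.
Proof. by case: z => a b /=; rewrite -sqrtr_sqr ler_sqrt ?lerDl ?addr_ge0 ?sqr_ge0. Qed.

Lemma normr_Im_le z : `|Im z| <= normc z.
Proof. by case: z => a b /=; rewrite -sqrtr_sqr ler_sqrt ?lerDr ?addr_ge0 ?sqr_ge0. Qed.

Lemma normc_le_Re_Im z : normc z <= `|Re z| + `|Im z|.
Proof.
case: z => a b /=; rewrite -[leRHS]ger0_norm ?addr_ge0// -sqrtr_sqr ler_sqrt ?sqr_ge0//.
rewrite sqrrD !real_normK ?num_real// addrAC lerDl.
by rewrite mulrn_wge0// mulr_ge0.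
Qed.

Lemma ReD z w : Re (z + w) = Re z + Re w. Proof. by case: z w => ? ? []. Qed.
Lemma ImD z w : Im (z + w) = Im z + Im w. Proof. by case: z w => ? ? []. Qed.
Lemma ReN z : Re (- z) = - Re z. Proof. by case: z. Qed.
Lemma ImN z : Im (- z) = - Im z. Proof. by case: z. Qed.
Lemma ReM z w : Re (z * w) = Re z * Re w - Im z * Im w.
Proof. by case: z w => ? ? []. Qed.
Lemma ImM z w : Im (z * w) = Re z * Im w + Im z * Re w.
Proof. by case: z w => ? ? []. Qed.

Lemma eqReIm z w : Re z = Re w -> Im z = Im w -> z = w.
Proof. by case: z w => a b [c d] /= -> ->. Qed.

Lemma expCD z w : expC (z + w) = expC z * expC w.
Proof.
apply: eqReIm; rewrite ?ReM ?ImM /expC /= ReD ImD expRD ?cosD ?sinD; ring.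
Qed.

Lemma expC0 : expC 0 = 1 :> R[i].
Proof. by rewrite /expC /= expR0 cos0 sin0 mulr0 mulr1. Qed.

Lemma normc_expC z : normc (expC z) = expR (Re z).
Proof.
rewrite /expC /=; have -> : (expR (Re z) * cos (Im z)) ^+ 2 + (expR (Re z) * sin (Im z)) ^+ 2
   = expR (Re z) ^+ 2 by rewrite !exprMn -mulrDr cos2Dsin2 mulr1.
by rewrite sqrtr_sqr gtr0_norm ?expR_gt0.
Qed.

End ComplexModulus.

Section ComplexDerivative.
Context {R : realType}.
Implicit Types (f g : R -> R[i]) (z w d e : R[i]) (t : R).

Definition is_Cderive f t d :=
  is_derive t (1 : R) (Re \o f) (Re d) /\ is_derive t (1 : R) (Im \o f) (Im d).

Lemma is_Cderive_cst z t : is_Cderive (fun=> z) t 0.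
Proof. by split; exact: is_derive_cst. Qed.

Lemma is_CderiveD f g t d e : is_Cderive f t d -> is_Cderive g t e ->
  is_Cderive (fun t => f t + g t) t (d + e).
Proof.
move=> [fR fI] [gR gI]; split; rewrite ?ReD ?ImD.
- have -> : Re \o (fun t => f t + g t) = (Re \o f) + (Re \o g).
    by apply/funext => s /=; rewrite ReD.
  exact: is_deriveD.
- have -> : Im \o (fun t => f t + g t) = (Im \o f) + (Im \o g).
    by apply/funext => s /=; rewrite ImD.
  exact: is_deriveD.
Qed.

Lemma is_CderiveM f g t d e : is_Cderive f t d -> is_Cderive g t e ->
  is_Cderive (fun t => f t * g t) t (d * g t + f t * e).
Proof.
move=> [fR fI] [gR gI]; split; rewrite ?ReD ?ImD ?ReM ?ImM.
- have -> : Re \o (fun t => f t * g t) = (Re \o f) * (Re \o g) - (Im \o f) * (Im \o g).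
    by apply/funext => s /=; rewrite ReM.
  apply: is_derive_eq; rewrite /GRing.scale/=; ring.
- have -> : Im \o (fun t => f t * g t) = (Re \o f) * (Im \o g) + (Im \o f) * (Re \o g).
    by apply/funext => s /=; rewrite ImM.
  apply: is_derive_eq; rewrite /GRing.scale/=; ring.
Qed.

Lemma is_Cderive_eq f t d e : is_Cderive f t d -> d = e -> is_Cderive f t e.
Proof. by move=> ? <-. Qed.

Lemma is_Cderive_real t : is_Cderive (fun t => t%:C) t 1.
Proof. by split; [exact: is_derive_id | exact: is_derive_cst]. Qed.

Lemma is_CderiveX f t d n : is_Cderive f t d ->
  is_Cderive (fun t => f t ^+ n.+1) t (n.+1%:R * f t ^+ n * d).
Proof.
move=> df; elim: n => [|n IH]; first by rewrite mul1r expr0 mul1r.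
have -> : (fun t => f t ^+ n.+2) = (fun t => f t * f t ^+ n.+1).
  by apply/funext => s; rewrite exprS.
apply: is_Cderive_eq (is_CderiveM df IH) _.
rewrite -[n.+2%:R]natr1 [f t ^+ n.+1]exprS; ring.
Qed.

Lemma is_Cderive_expC z t :
  is_Cderive (fun t => expC (z * t%:C)) t (z * expC (z * t%:C)).
Proof.
have RE s : Re (z * s%:C) = s * Re z by rewrite ReM /= mulr0 subr0 mulrC.
have IE s : Im (z * s%:C) = s * Im z by rewrite ImM /= mulr0 add0r mulrC.
split; rewrite ?ReM ?ImM /expC/=; rewrite RE IE.
- have -> : Re \o (fun t => expC (z * t%:C)) =
      (expR \o (fun s => s * Re z)) * (cos \o (fun s => s * Im z)).
    by apply/funext => s /=; rewrite RE IE.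
  apply: is_derive_eq; rewrite /GRing.scale/=; ring.
- have -> : Im \o (fun t => expC (z * t%:C)) =
      (expR \o (fun s => s * Re z)) * (sin \o (fun s => s * Im z)).
    by apply/funext => s /=; rewrite RE IE.
  apply: is_derive_eq; rewrite /GRing.scale/=; ring.
Qed.

Lemma Cderive_continuous f t d : is_Cderive f t d ->
  {for t, continuous (Re \o f)} /\ {for t, continuous (Im \o f)}.
Proof.
by case=> -[dR _] [dI _]; split; apply/differentiable_continuous/derivable1_diffP.
Qed.

Local Notation mu := (@lebesgue_measure R).

Lemma Cintegral_FTC2 f F (T : R) : 0 <= T -> (forall t, is_Cderive F t (f t)) ->
  (forall t, {for t, continuous (Re \o f)}) ->
  (forall t, {for t, continuous (Im \o f)}) ->
  Cintegral `[0, T] f = F T - F 0.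
Proof.
rewrite le_eqVlt => /predU1P[<- _ _ _|T0 dF cR cI].
  by rewrite subrr /Cintegral set_itv1 !Rintegral_set1.
have FTC (h H : R -> R) : (forall t, is_derive t (1 : R) H (h t)) ->
    (forall t, {for t, continuous h}) -> Rintegral mu `[0, T] h = H T - H 0.
  move=> dH ch; rewrite /Rintegral (continuous_FTC2 T0 (F := H)) //.
  - by apply: continuous_subspaceT => t; exact: ch.
  - have cH t : {for t, continuous H}.
      by apply/differentiable_continuous/derivable1_diffP; case: (dH t).
    split.
    + by move=> t _; case: (dH t).
    + exact: cvg_at_right_filter (cH _).
    + exact: cvg_at_left_filter (cH _).
  - by move=> t _; rewrite derive1E; case: (dH t).
have RE := FTC _ (Re \o F) (fun t => (dF t).1) cR.
have IE := FTC _ (Im \o F) (fun t => (dF t).2) cI.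
rewrite /Cintegral RE IE; by apply: eqReIm; rewrite /= ?ReD ?ImD ?ReN ?ImN.
Qed.

End ComplexDerivative.

(** * Gamma kernels and their tails *)

Section GammaKernel.
Context {R : realType}.
Implicit Types (z : R[i]) (t T a x : R) (k n : nat).

Definition gkernel k z t : R[i] := t%:C ^+ k / k`!%:R * expC (- (z * t%:C)).

(** The regularized incomplete gamma function: for Re z > 0, gtail k z t is
    z^(k+1) times the integral of gkernel k z over [t, +oo[, in the closed form
    obtained by repeated integration by parts. *)
Definition gtail k z t : R[i] :=
  expC (- (z * t%:C)) * \sum_(j < k.+1) (z * t%:C) ^+ j / j`!%:R.

Lemma factC_neq0 n : n`!%:R != 0 :> R[i].
Proof. by rewrite pnatr_eq0 -lt0n fact_gt0. Qed.

Lemma gtail0 k z : gtail k z 0 = 1.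
Proof.
rewrite /gtail mulr0 oppr0 expC0 mul1r big_ord_recl expr0 fact0 divr1 big1 ?addr0//.
by move=> j _; rewrite lift0 expr0n mul0r.
Qed.

Lemma is_Cderive_expCN z t :
  is_Cderive (fun t => expC (- (z * t%:C))) t (- z * expC (- (z * t%:C))).
Proof.
have -> : (fun t => expC (- (z * t%:C))) = (fun t => expC (- z * t%:C)).
  by apply/funext => s; rewrite mulNr.
by rewrite -mulNr; exact: is_Cderive_expC.
Qed.

(** The sum telescopes: the derivative of its j-th term times the exponential
    is the difference of two consecutive kernels. *)
Lemma is_Cderive_gtail k z t :
  is_Cderive (gtail k z) t (- z ^+ k.+1 * gkernel k z t).
Proof.
elim: k => [|k IH].
  have -> : gtail 0 z = (fun t => expC (- (z * t%:C))).
    by apply/funext => s; rewrite /gtail big_ord1 expr0 fact0 divr1 mulr1.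
  apply: is_Cderive_eq (is_Cderive_expCN z t) _.
  by rewrite /gkernel expr1 expr0 fact0 divr1 mul1r.
have -> : gtail k.+1 z = (fun t => gtail k z t +
    (z ^+ k.+1 / k.+1`!%:R * t%:C ^+ k.+1) * expC (- (z * t%:C))).
  by apply/funext => s; rewrite /gtail big_ord_recr mulrDr /= exprMn; congr (_ + _); ring.
have dX := is_CderiveX k (is_Cderive_real t).
have dcX := is_CderiveM (is_Cderive_cst (z ^+ k.+1 / k.+1`!%:R) t) dX.
apply: is_Cderive_eq (is_CderiveD IH (is_CderiveM dcX (is_Cderive_expCN z t))) _.
have k1 : k.+1%:R != 0 :> R[i] by rewrite pnatr_eq0.
have kf := factC_neq0 k.
rewrite /gkernel factS natrM; move: (expC _) => E.
rewrite ![_ ^+ k.+2]exprS ![_ ^+ k.+1]exprS.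
by field; rewrite kf nat1r k1.
Qed.

Lemma is_Cderive_gkernel k z t : exists d, is_Cderive (gkernel k z) t d.
Proof.
have dk : exists d, is_Cderive (fun t => t%:C ^+ k) t d.
  case: k => [|k]; last by eexists; exact: is_CderiveX (is_Cderive_real t).
  by exists 0; exact: is_Cderive_cst.
case: dk => d dk; eexists; apply: is_CderiveM _ (is_Cderive_expCN z t).
exact: is_CderiveM dk (is_Cderive_cst _ _).
Qed.

Lemma continuous_gkernel k z t :
  {for t, continuous (Re \o gkernel k z)} /\ {for t, continuous (Im \o gkernel k z)}.
Proof. by have [d] := is_Cderive_gkernel k z t; exact: Cderive_continuous. Qed.

Lemma Cintegral_gkernel k z T : z != 0 -> 0 <= T ->
  Cintegral `[0, T] (gkernel k z) = (1 - gtail k z T) / z ^+ k.+1.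
Proof.
move=> z0 T0.
rewrite (@Cintegral_FTC2 _ _ (fun t => - (z ^- k.+1) * gtail k z t) _ T0) /=.
- by rewrite gtail0; ring.
- move=> t; apply: is_Cderive_eq (is_CderiveM (is_Cderive_cst _ t) (is_Cderive_gtail k z t)) _.
  by field; rewrite expf_neq0.
- by move=> t; case: (continuous_gkernel k z t).
- by move=> t; case: (continuous_gkernel k z t).
Qed.

Lemma exp_partial_sum_le x n : 0 <= x -> \sum_(j < n) x ^+ j / j`!%:R <= expR x.
Proof.
move=> x0; rewrite -(big_mkord xpredT (fun j => x ^+ j / j`!%:R)).
apply: (@nondecreasing_cvgn_le _ (series (exp_coeff x))).
  apply/nondecreasing_seqP => m; rewrite seriesSr lerDl.
  by rewrite /exp_coeff/= divr_ge0 ?exprn_ge0.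
exact: is_cvg_series_exp_coeff.
Qed.

Lemma exp_term_le x n : 0 <= x -> x ^+ n / n`!%:R <= expR x.
Proof.
move=> x0; apply: le_trans (exp_partial_sum_le n.+1 x0).
by rewrite big_ord_recr /= lerDr sumr_ge0// => j _; rewrite divr_ge0 ?exprn_ge0.
Qed.

Lemma normc_nat n : normc (n%:R : R[i]) = n%:R.
Proof. by rewrite -(rmorph_nat (real_complex R)) normc_real normr_nat. Qed.

Lemma ReMr z t : Re (z * t%:C) = Re z * t.
Proof. by rewrite ReM /= mulr0 subr0. Qed.

Lemma normc_gkernel k z t : 0 <= t ->
  normc (gkernel k z t) = t ^+ k / k`!%:R * expR (- (Re z * t)).
Proof.
move=> t0; rewrite /gkernel !normcM normcX normcV normc_nat normc_real ger0_norm//.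
by rewrite normc_expC ReN ReMr.
Qed.

Lemma normc_sum (I : Type) (s : seq I) (P : pred I) (F : I -> R[i]) :
  normc (\sum_(i <- s | P i) F i) <= \sum_(i <- s | P i) normc (F i).
Proof.
elim/big_ind2 : _ => // [|x1 x2 y1 y2 h1 h2].
- by rewrite normc0.
- exact: le_trans (normcD _ _) (lerD h1 h2).
Qed.

(** The factor (Re z / |z|)^(k+1) turns each (|z| t)^j with j <= k into at most
    (Re z * t)^j, which removes the oscillation from the estimate. *)
Lemma normc_gtail_le k z t : 0 < Re z -> 0 <= t ->
  (Re z / normc z) ^+ k.+1 * normc (gtail k z t) <=
  expR (- (Re z * t)) * \sum_(j < k.+1) (Re z * t) ^+ j / j`!%:R.
Proof.
move=> a0 t0; set a := Re z in a0 *.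
have za : a <= normc z by apply: le_trans (normr_Re_le z); rewrite ler_norm.
have z0 : 0 < normc z by exact: lt_le_trans za.
rewrite /gtail normcM normc_expC ReN ReMr mulrCA ler_pM2l ?expR_gt0//.
apply: le_trans (ler_wpM2l _ (normc_sum _ _ _)) _; first by rewrite exprn_ge0// divr_ge0 // ltW.
rewrite mulr_sumr; apply: ler_sum => j _.
rewrite normcM normcX normcM normcV normc_nat normc_real ger0_norm// mulrA.
rewrite ler_wpM2r//.
have -> : (a / normc z) ^+ k.+1 = (a / normc z) ^+ (k.+1 - j) * (a / normc z) ^+ j.
  by rewrite -exprD subnK// ltnW.
rewrite -mulrA -exprMn.
have -> : a / normc z * (normc z * t) = a * t by field; rewrite gt_eqF.
rewrite ler_piMl//; first by rewrite exprn_ge0// mulr_ge0// ltW.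
by rewrite exprn_ile1// ?divr_ge0 ?ler_pdivrMr ?mul1r// ltW.
Qed.

Lemma normc_gtail_le1 k z t : 0 < Re z -> 0 <= t ->
  (Re z / normc z) ^+ k.+1 * normc (gtail k z t) <= 1.
Proof.
move=> a0 t0; apply: le_trans (normc_gtail_le _ a0 t0) _.
by rewrite mulrC expRN ler_pdivrMr ?expR_gt0// mul1r exp_partial_sum_le// mulr_ge0// ltW.
Qed.

(** Chernoff bound: half of the exponential is kept and the other half pays for
    the sum, at the price of 2^k.  It shows that a packet dies out exponentially
    long after its peak k / Re z. *)
Lemma normc_gtail_le_expR k z t : 0 < Re z -> 0 <= t ->
  (Re z / normc z) ^+ k.+1 * normc (gtail k z t) <= 2 ^+ k * expR (- (Re z * t / 2)).
Proof.
move=> a0 t0; apply: le_trans (normc_gtail_le _ a0 t0) _.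
have -> : expR (- (Re z * t)) = expR (- (Re z * t / 2)) / expR (Re z * t / 2).
  by rewrite -expRN -expRD; congr expR; field.
rewrite mulrAC -mulrA [leLHS]mulrC ler_wpM2r ?expR_ge0// ler_pdivrMr ?expR_gt0//.
apply: (@le_trans _ _ (2 ^+ k * \sum_(j < k.+1) (Re z * t / 2) ^+ j / j`!%:R)).
  rewrite mulr_sumr; apply: ler_sum => j _; rewrite mulrA ler_wpM2r//.
  rewrite [in leRHS]exprMn exprVn mulrCA.
  rewrite ler_peMr ?exprn_ge0 ?mulr_ge0 ?(ltW a0)//.
  by rewrite ler_pdivlMr ?exprn_gt0// mul1r ler_eXn2l ?ltr1n// leq_ord.
by rewrite ler_wpM2l ?exprn_ge0// exp_partial_sum_le// !mulr_ge0// ltW.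
Qed.

(** The series of exp (a t) bounds both (a t)^k / k! and (a t)^(k+2) / (k+2)!;
    the second bound yields the decay 1 / (1 + t^2) at a quadratic cost in k. *)
Lemma normc_gkernel_le k z t : 0 < Re z -> 0 <= t ->
  Re z ^+ k.+1 * normc (gkernel k z t) <=
  (Re z + k.+2%:R ^+ 2 / Re z) / (1 + t ^+ 2).
Proof.
move=> a0 t0; rewrite normc_gkernel//; set a := Re z in a0 *.
have at0 : 0 <= a * t by rewrite mulr_ge0// ltW.
have d0 : 0 < 1 + t ^+ 2 by rewrite ltr_pwDl// sqr_ge0.
rewrite ler_pdivlMr//.
have -> : a ^+ k.+1 * (t ^+ k / k`!%:R * expR (- (a * t))) * (1 + t ^+ 2) =
   a * ((a * t) ^+ k / k`!%:R / expR (a * t)) +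
   (k.+2 * k.+1)%:R / a * ((a * t) ^+ k.+2 / k.+2`!%:R / expR (a * t)).
  rewrite expRN !exprMn !factS !natrM !exprS.
  have k1 : k.+1%:R != 0 :> R by rewrite pnatr_eq0.
  have k2 : k.+2%:R != 0 :> R by rewrite pnatr_eq0.
  have kf : k`!%:R != 0 :> R by rewrite pnatr_eq0 -lt0n fact_gt0.
  clearbody a; field.
  by rewrite kf nat1r k1 -natrD add2n k2 !gt_eqF ?expR_gt0.
apply: lerD.
  by rewrite ler_piMr ?(ltW a0)// ler_pdivrMr ?expR_gt0// mul1r exp_term_le.
apply: (@le_trans _ _ ((k.+2 * k.+1)%:R / a)).
  rewrite ler_piMr ?divr_ge0 ?(ltW a0)//.
  by rewrite ler_pdivrMr ?expR_gt0// mul1r exp_term_le.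
by rewrite ler_wpM2r ?invr_ge0 ?(ltW a0)// -natrX ler_nat leq_mul.
Qed.

End GammaKernel.

(** * Series with a geometric majorant *)

Section GeometricallyDominatedSeries.
Context {R : realType}.
Implicit Types (a : nat -> R) (u v : nat -> R[i]) (C D : R) (s z : R[i]).

Lemma geometric_partial_sum C N :
  \sum_(0 <= n < N) C / 2 ^+ n.+1 = C - C / 2 ^+ N.
Proof.
elim: N => [|N IH]; first by rewrite big_nil expr0 divr1 subrr.
rewrite big_nat_recr//= IH exprS.
have N0 : 2 ^+ N != 0 :> R by rewrite expf_neq0.
by field.
Qed.

Lemma geo_partial_sum_le a C N : (forall n, `|a n| <= C / 2 ^+ n.+1) ->
  `|series a N| <= C.
Proof.
move=> aC; have C0 : 0 <= C.
  by have := le_trans (normr_ge0 _) (aC 0); rewrite pmulr_lge0// invr_gt0 exprn_gt0.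
apply: le_trans (ler_norm_sum _ _ _) _.
apply: le_trans (ler_sum _ (fun n _ => aC n)) _.
by rewrite geometric_partial_sum gerBl divr_ge0// exprn_ge0.
Qed.

Lemma geo_series_cvg a C : (forall n, `|a n| <= C / 2 ^+ n.+1) -> cvgn (series a).
Proof.
move=> aC; apply: normed_cvg.
apply: (@nondecreasing_is_cvgn _ [normed series a]).
  by apply/nondecreasing_seqP => n; rewrite /= !seriesEnat/= big_nat_recr//= lerDl.
exists C => _ [N _ <-].
rewrite /= -[leLHS]ger0_norm; last by apply: sumr_ge0.
by apply: (@geo_partial_sum_le (fun n => `|a n|)) => n; rewrite normr_id.
Qed.

Lemma geo_series_lim_le a C : (forall n, `|a n| <= C / 2 ^+ n.+1) ->
  `|limn (series a)| <= C.
Proof.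
move=> aC; have ca := geo_series_cvg aC.
rewrite ler_norml; apply/andP; split.
- apply: limr_ge => //; apply: nearW => N.
  by have := geo_partial_sum_le N aC; rewrite ler_norml => /andP[].
- apply: limr_le => //; apply: nearW => N.
  by have := geo_partial_sum_le N aC; rewrite ler_norml => /andP[].
Qed.

(** The limit is taken in each component, so that convergence and integration of
    complex series reduce to real ones. *)
Definition csum u : R[i] := limn (series (Re \o u)) +i* limn (series (Im \o u)).

(** The weights 1 / 2^(n+1) add up to 1, so C also bounds the partial sums. *)
Definition geodom C u := forall n, normc (u n) <= C / 2 ^+ n.+1.

Definition is_csum u s :=
  (series (Re \o u) @ \oo --> Re s) /\ (series (Im \o u) @ \oo --> Im s).

Lemma geodomRe C u : geodom C u -> forall n, `|(Re \o u) n| <= C / 2 ^+ n.+1.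
Proof. by move=> uC n; apply: le_trans (uC n); exact: normr_Re_le. Qed.

Lemma geodomIm C u : geodom C u -> forall n, `|(Im \o u) n| <= C / 2 ^+ n.+1.
Proof. by move=> uC n; apply: le_trans (uC n); exact: normr_Im_le. Qed.

Lemma geodom_is_csum C u : geodom C u -> is_csum u (csum u).
Proof.
move=> uC; split; [exact: geo_series_cvg (geodomRe uC)|].
exact: geo_series_cvg (geodomIm uC).
Qed.

Lemma is_csum_eq u s : is_csum u s -> csum u = s.
Proof. by case=> uR uI; apply: eqReIm; apply/cvg_lim. Qed.

Lemma csum_le C u : geodom C u -> normc (csum u) <= 2 * C.
Proof.
move=> uC; apply: le_trans (normc_le_Re_Im _) _; rewrite mulr_natl mulr2n.
apply: lerD; first exact: geo_series_lim_le (geodomRe uC).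
exact: geo_series_lim_le (geodomIm uC).
Qed.

Lemma is_csumD u v s z : is_csum u s -> is_csum v z ->
  is_csum (fun n => u n + v n) (s + z).
Proof.
move=> [uR uI] [vR vI]; split.
- have -> : series (Re \o (fun n => u n + v n)) = series (Re \o u) + series (Re \o v).
    by rewrite -seriesD; congr series; apply/funext => n /=; rewrite ReD.
  by rewrite ReD; exact: cvgD.
- have -> : series (Im \o (fun n => u n + v n)) = series (Im \o u) + series (Im \o v).
    by rewrite -seriesD; congr series; apply/funext => n /=; rewrite ImD.
  by rewrite ImD; exact: cvgD.
Qed.

Lemma is_csumM u s z : is_csum u s -> is_csum (fun n => z * u n) (z * s).
Proof.
move=> [uR uI]; split.
- have -> : series (Re \o (fun n => z * u n)) =
      Re z *: series (Re \o u) - Im z *: series (Im \o u).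
    by rewrite -!seriesZ -seriesN -seriesD; congr series; apply/funext => n /=; rewrite ReM.
  by rewrite ReM; apply: cvgB; exact: cvgZl_tmp.
- have -> : series (Im \o (fun n => z * u n)) =
      Re z *: series (Im \o u) + Im z *: series (Re \o u).
    by rewrite -!seriesZ -seriesD; congr series; apply/funext => n /=; rewrite ImM.
  by rewrite ImM; apply: cvgD; exact: cvgZl_tmp.
Qed.

Lemma is_csumB u v s z : is_csum u s -> is_csum v z ->
  is_csum (fun n => u n - v n) (s - z).
Proof.
move=> us vz; have := is_csumD us (is_csumM (-1) vz); rewrite mulN1r.
by under eq_fun do rewrite mulN1r.
Qed.

Lemma is_csum_single n z : is_csum (fun m => if m == n then z else 0) z.
Proof.
have single (x : R) : series (fun m => if m == n then x else 0) @ \oo --> x.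
  apply: cvg_near_cst; near=> N; rewrite seriesEnat/= -big_mkcond /=.
  rewrite (big_nat1_eq _ (fun=> x)) leq0n/=.
  by case: ifPn => //; rewrite -leqNgt leqNgt; case/negP; near: N; exact: nbhs_infty_gt.
split.
- have -> : Re \o (fun m => if m == n then z else 0) = (fun m => if m == n then Re z else 0).
    by apply/funext => m /=; case: ifP.
  exact: single.
- have -> : Im \o (fun m => if m == n then z else 0) = (fun m => if m == n then Im z else 0).
    by apply/funext => m /=; case: ifP.
  exact: single.
Unshelve. all: by end_near. Qed.

(** One term dominates the sum as soon as the rest has a small majorant. *)
Lemma csum_ge_single C u n : geodom C (fun m => if m == n then 0 else u m) ->
  normc (u n) - 2 * C <= normc (csum u).
Proof.
move=> rC; have := is_csumD (is_csum_single n (u n)) (geodom_is_csum rC).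
have -> : (fun m => (if m == n then u n else 0) + (if m == n then 0 else u m)) = u.
  by apply/funext => m; case: eqVneq => [->|_]; rewrite ?addr0 ?add0r.
move=> /is_csum_eq ->; apply: le_trans (normc_distD _ _).
by rewrite lerB// csum_le.
Qed.

(** Term-by-term differentiation.  A remainder of order |h|^2 uniformly in n, up
    to a summable weight, survives summation and division by h. *)
Lemma derivable_csum (U : nat -> R[i] -> R[i]) u z r C : 0 < r ->
  geodom C u -> (forall h, normc h < r -> geodom C (fun n => U n (z + h))) ->
  (forall h, normc h < r ->
     geodom (C * normc h ^+ 2) (fun n => U n (z + h) - U n z - h * u n)) ->
  derivable ((fun w => csum (fun n => U n w)) : R[i]^o -> R[i]^o) z 1.
Proof.
move=> r0 uC UC remC; apply/cvg_ex; exists (csum u : R[i]^o).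
apply/(@cvgrPdist_le R[i] R[i]^o) => e e0.
have [e' -> e'0] : exists2 e', e = e'%:C & 0 < e'.
  by move: e0; case: e => a b; rewrite ltcE /= => /andP[/eqP -> a0]; exists a.
have C0 : 0 <= C.
  by have := le_trans (normc_ge0 _) (uC 0%N); rewrite pmulr_lge0// invr_gt0 exprn_gt0.
have d0 : 0 < Num.min r (e' / (2 * C + 1)).
  by rewrite lt_min r0 divr_gt0// ltr_wpDl// mulr_ge0.
near=> h.
have h0 : h != 0 by near: h; exact: nbhs_dnbhs_neq.
have : `|h| < (Num.min r (e' / (2 * C + 1)))%:C.
  by near: h; apply: dnbhs0_lt; rewrite ltcR.
rewrite ltcR lt_min => /andP[hr he].
have nh0 : 0 < normc h by exact: normc_gt0.
have U0 : geodom C (fun n => U n z).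
  by have := UC 0; rewrite normc0 => /(_ r0); rewrite addr0.
have remE := is_csum_eq (is_csumB (is_csumB (geodom_is_csum (UC h hr))
  (geodom_is_csum U0)) (is_csumM h (geodom_is_csum uC))).
have := csum_le (remC h hr); rewrite remE => rem_le.
rewrite /= lecR [h *: _]mulr1 addrC [h + z]addrC.
rewrite -normcN opprD opprK.
set A := csum _ - csum _ in rem_le *.
have -> : (h^-1 *: A : R[i]^o) - csum u = h^-1 * (A - h * csum u).
  by rewrite mulrBr mulrA mulVf// mul1r.
rewrite normcM normcV mulrC ler_pdivrMr//.
apply: le_trans rem_le _.
rewrite expr2 mulrA mulrA ler_wpM2r// ?normc_ge0//.
apply: (@le_trans _ _ ((2 * C + 1) * normc h)).
  by rewrite ler_wpM2r ?normc_ge0// lerDl.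
by rewrite mulrC -ler_pdivlMr ?ltr_wpDl ?mulr_ge0// ltW.
Unshelve. all: by end_near. Qed.

End GeometricallyDominatedSeries.

(** * Integration on the half-line *)

Section Integration.
Context {R : realType}.
Local Notation mu := (@lebesgue_measure R).
Implicit Types (D : set R) (v : R -> R) (C t : R) (z : R[i]) (k n N : nat).

Lemma Rintegral_dominated_cvg D (f_ : nat -> R -> R) f v : measurable D ->
  (forall n, measurable_fun D (f_ n)) ->
  (forall t, D t -> f_ ^~ t @ \oo --> f t) ->
  mu.-integrable D (EFin \o v) ->
  (forall n t, D t -> `|f_ n t| <= v t) ->
  (fun n => Rintegral mu D (f_ n)) @ \oo --> Rintegral mu D f.
Proof.
move=> mD mf_ cf iv fv.
have mf := measurable_fun_cvg mf_ cf.
have [|||||iF _ cI] := @dominated_convergence _ _ _ mu D mD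
   (fun n => EFin \o f_ n) (EFin \o f) (EFin \o v).
- by move=> n; apply/measurable_EFinP; exact: mf_.
- exact/measurable_EFinP.
- apply: aeW => t Dt; apply: cvg_EFin; first exact: nearW.
  exact: cf.
- exact: iv.
- by apply: aeW => t n Dt; rewrite /= lee_fin; exact: fv.
apply: fine_cvg; rewrite fineK; last exact: integrable_fin_num.
exact: cI.
Qed.

Lemma dominated_integrable_fun D (f : R -> R) v : measurable D -> measurable_fun D f ->
  mu.-integrable D (EFin \o v) -> (forall t, D t -> `|f t| <= v t) ->
  mu.-integrable D (EFin \o f).
Proof.
move=> mD mf iv fv; apply: le_integrable iv => //; first exact/measurable_EFinP.
by move=> t Dt; rewrite /= lee_fin; exact: le_trans (fv t Dt) (ler_norm _).
Qed.

(** Dominated convergence for the partial sums, which v itself dominates. *)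
Lemma Rintegral_geo_series D (a : nat -> R -> R) v : measurable D ->
  (forall n, measurable_fun D (a n)) ->
  mu.-integrable D (EFin \o v) ->
  (forall n t, D t -> `|a n t| <= v t / 2 ^+ n.+1) ->
  series (fun n => Rintegral mu D (a n)) @ \oo -->
    Rintegral mu D (fun t => limn (series (a ^~ t))).
Proof.
move=> mD ma iv av.
have av1 n t : D t -> `|a n t| <= v t.
  move=> Dt; apply: le_trans (av n t Dt) _.
  have v0 : 0 <= v t.
    have := le_trans (normr_ge0 _) (av n t Dt).
    by rewrite pmulr_lge0// invr_gt0 exprn_gt0.
  by rewrite ler_piMr// invf_le1 ?exprn_gt0// exprn_ege1// ler1n.
have ia n := dominated_integrable_fun mD (ma n) iv (av1 n).
have SE : series (fun n => Rintegral mu D (a n)) =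
    (fun N => Rintegral mu D (fun t => series (a ^~ t) N)).
  apply/funext; elim=> [|N IH].
    rewrite /Rintegral /series /= big_geq//.
    by under eq_integral do rewrite big_geq//; rewrite integral0.
  rewrite seriesSr IH -RintegralD//.
    by apply: eq_Rintegral => t _; rewrite seriesSr.
  have -> : EFin \o (fun t => series (a ^~ t) N) =
      (fun t => \sum_(0 <= i < N) (EFin \o a i) t)%E.
    by apply/funext => t /=; rewrite sumEFin seriesEnat.
  exact: integrable_sum.
rewrite SE; apply: Rintegral_dominated_cvg iv _ => //.
- by move=> N; rewrite /series /=; exact: measurable_sum.
- by move=> t Dt; exact: geo_series_cvg (fun n => av n t Dt).
- by move=> N t Dt; exact: geo_partial_sum_le (fun n => av n t Dt).
Qed.

Lemma Cintegral_csum D (u : nat -> R -> R[i]) v : measurable D ->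
  (forall n, measurable_fun D (Re \o u n)) ->
  (forall n, measurable_fun D (Im \o u n)) ->
  mu.-integrable D (EFin \o v) ->
  (forall t, D t -> geodom (v t) (u ^~ t)) ->
  Cintegral D (fun t => csum (u ^~ t)) = csum (fun n => Cintegral D (u n)).
Proof.
move=> mD mR mI iv uv; apply/esym/is_csum_eq; split.
- exact: (Rintegral_geo_series mD mR iv (fun n t Dt => geodomRe (uv t Dt) n)).
- exact: (Rintegral_geo_series mD mI iv (fun n t Dt => geodomIm (uv t Dt) n)).
Qed.

Lemma measurable_half_line : measurable (half_line : set R).
Proof. exact: measurable_itv. Qed.
Hint Resolve measurable_half_line : core.

Lemma half_lineE t : half_line t = (0 <= t) :> Prop.
Proof. by rewrite /half_line/= in_itv/= andbT. Qed.

(** A single majorant for all purposes: it is integrable on the half-line, stays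
    integrable when raised to a power at least 1, and bounds every packet. *)
Definition cauchy_dom C t : R := C / (1 + t ^+ 2).

Lemma integrable_cauchy_dom C : mu.-integrable half_line (EFin \o cauchy_dom C).
Proof.
have m1 : measurable_fun half_line (fun t : R => (oneDsqr t)^-1).
  apply: measurable_funTS; apply: continuous_measurable_fun.
  exact: continuous_oneDsqrV.
have i1 : mu.-integrable half_line (EFin \o (fun t : R => (oneDsqr t)^-1)).
  apply/integrableP; split; first exact/measurable_EFinP.
  under eq_integral => t _.
    rewrite /= ger0_norm; last by rewrite invr_ge0 addr_ge0// sqr_ge0.
    over.
  by rewrite integral0y_oneDsqr ltry.
have -> : EFin \o cauchy_dom C = (fun t => C%:E * ((oneDsqr t)^-1)%:E)%E.
  by apply/funext => t.
exact: (@integrableZl _ _ _ mu _ measurable_half_line).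
Qed.

(** Integrals over the half-line are limits of integrals over segments, where the
    fundamental theorem of calculus gives closed forms also for oscillating
    integrands. *)
Lemma Rintegral_exhaustion (f : R -> R) C : measurable_fun half_line f ->
  (forall t, 0 <= t -> `|f t| <= cauchy_dom C t) ->
  (fun n => Rintegral mu `[0, n%:R] f) @ \oo --> Rintegral mu half_line f.
Proof.
move=> mf fC.
have -> : (fun n => Rintegral mu `[0, n%:R] f) =
    (fun n => Rintegral mu half_line (f \_ `[0, n%:R])).
  apply/funext => n; rewrite -Rintegral_mkcondr; congr (Rintegral mu _ f).
  rewrite setIidr// => t /=; rewrite half_lineE in_itv/= => /andP[]//.
apply: Rintegral_dominated_cvg (integrable_cauchy_dom C) _ => //.
- move=> n; apply/measurable_restrict => //.
  by apply: measurable_funS mf => //; exact: subIsetl.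
- move=> t; rewrite half_lineE => t0; apply: cvg_near_cst; near=> n.
  rewrite patchE mem_set//= in_itv/= t0/=.
  by near: n; exact: nbhs_infty_ger.
- move=> n t; rewrite half_lineE => t0; rewrite patchE; case: ifP => _; first exact: fC.
  by rewrite normr0; apply: le_trans (normr_ge0 _) (fC t t0).
Unshelve. all: by end_near. Qed.

Lemma Cintegral_half_line (f : R -> R[i]) C (l : R[i]) (e : nat -> R) :
  measurable_fun half_line (Re \o f) -> measurable_fun half_line (Im \o f) ->
  (forall t, 0 <= t -> normc (f t) <= cauchy_dom C t) ->
  (forall n, normc (Cintegral `[0, n%:R] f - l) <= e n) -> e @ \oo --> 0 ->
  Cintegral half_line f = l.
Proof.
move=> mR mI fC fl e0.
have toward (a : nat -> R) (x : R) : (forall n, `|a n - x| <= e n) -> a @ \oo --> x.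
  move=> ae; apply/cvgrPdist_le => d d0; near=> n.
  rewrite distrC; apply: le_trans (ae n) _; apply: le_trans (ler_norm _) _.
  rewrite -[e n]subr0; near: n.
  by move/cvgrPdist_le : e0 => /(_ d d0); apply: filterS => n; rewrite distrC.
have limE (a : nat -> R) (x y : R) : a @ \oo --> x -> a @ \oo --> y -> x = y.
  by move=> ax ay; rewrite -(cvg_lim _ ax)// -(cvg_lim _ ay).
apply: eqReIm => /=.
- have fR t : 0 <= t -> `|(Re \o f) t| <= cauchy_dom C t.
    by move=> t0; exact: le_trans (normr_Re_le _) (fC t t0).
  apply: limE (Rintegral_exhaustion mR fR) _.
  apply: toward => n; apply: le_trans (fl n).
  by have := normr_Re_le (Cintegral `[0, n%:R] f - l); rewrite ReD ReN.
- have fI t : 0 <= t -> `|(Im \o f) t| <= cauchy_dom C t.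
    by move=> t0; exact: le_trans (normr_Im_le _) (fC t t0).
  apply: limE (Rintegral_exhaustion mI fI) _.
  apply: toward => n; apply: le_trans (fl n).
  by have := normr_Im_le (Cintegral `[0, n%:R] f - l); rewrite ImD ImN.
Unshelve. all: by end_near. Qed.

Lemma measurable_gkernel D k z :
  measurable_fun D (Re \o gkernel k z) /\ measurable_fun D (Im \o gkernel k z).
Proof.
by split; apply: measurable_funTS; apply: continuous_measurable_fun => t;
  have [] := continuous_gkernel k z t.
Qed.

Lemma cvg_expR_lin (c : R) : 0 < c -> (fun n => expR (- (c * n%:R))) @ \oo --> (0 : R).
Proof.
move=> c0; have -> : (fun n => expR (- (c * n%:R))) = geometric 1 (expR (- c)).
  apply/funext => n; rewrite /= mul1r -expRM_natl; congr expR; ring.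
by apply: cvg_geometric; rewrite ger0_norm ?expR_ge0// expR_lt1 oppr_lt0.
Qed.

Lemma Cintegral_gkernel_half_line k z : 0 < Re z ->
  Cintegral half_line (gkernel k z) = (z ^+ k.+1)^-1.
Proof.
move=> a0; have za : Re z <= normc z by apply: le_trans (normr_Re_le z); rewrite ler_norm.
have nz : 0 < normc z by exact: lt_le_trans za.
have z0 : z != 0.
  by apply: contraTneq nz => ->; rewrite normc0 ltxx.
have aX : 0 < Re z ^+ k.+1 by rewrite exprn_gt0.
have [mR mI] := measurable_gkernel half_line k z.
pose M := 2 ^+ k / Re z ^+ k.+1.
apply: (Cintegral_half_line (C := (Re z + k.+2%:R ^+ 2 / Re z) / Re z ^+ k.+1)
  (e := fun n => M * expR (- (Re z / 2 * n%:R))) mR mI).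
- move=> t t0; rewrite /cauchy_dom mulrAC ler_pdivlMr// mulrC.
  exact: normc_gkernel_le.
- move=> n; rewrite Cintegral_gkernel// mulrBl mul1r addrC addKr normcN normcM normcV normcX.
  rewrite /M mulrAC ler_pdivlMr//.
  have -> : normc (gtail k z n%:R) / normc z ^+ k.+1 * Re z ^+ k.+1 =
     (Re z / normc z) ^+ k.+1 * normc (gtail k z n%:R).
    by rewrite expr_div_n [LHS]mulrAC [RHS]mulrAC; congr (_ / _); rewrite mulrC.
  by apply: le_trans (normc_gtail_le_expR _ _ _) _ => //; rewrite mulrAC.
- rewrite -[0 in X in _ --> X](mulr0 M).
  by apply: cvgMl_tmp; apply: cvg_expR_lin; rewrite divr_gt0.
Qed.

End Integration.

(** * Taylor remainder of a power of b / w *)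

Section PowerRemainder.
Context {R : realType}.
Implicit Types (x y h w : R[i]) (V b : R).

(** Induction on j through D_(m+1) = y D_m + m x^(m-1) (y - x)^2, where
    D_m = y^m - x^m - m x^(m-1) (y - x). *)
Lemma normc_exp_taylor x y V j : normc x <= V -> normc y <= V ->
  normc (y ^+ j.+2 - x ^+ j.+2 - j.+2%:R * x ^+ j.+1 * (y - x)) <=
  j.+2%:R ^+ 2 * V ^+ j * normc (y - x) ^+ 2.
Proof.
move=> xV yV; have V0 : 0 <= V by exact: le_trans (normc_ge0 _) xV.
elim: j => [|j IH].
  have -> : y ^+ 2 - x ^+ 2 - 2%:R * x ^+ 1 * (y - x) = (y - x) ^+ 2 by ring.
  by rewrite normcX expr0 mulr1 ler_peMl ?sqr_ge0// expr_ge1//; lra.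
have -> : y ^+ j.+3 - x ^+ j.+3 - j.+3%:R * x ^+ j.+2 * (y - x) =
   y * (y ^+ j.+2 - x ^+ j.+2 - j.+2%:R * x ^+ j.+1 * (y - x)) +
   j.+2%:R * x ^+ j.+1 * (y - x) ^+ 2.
  rewrite -[j.+3%:R]natr1 !exprS; ring.
apply: le_trans (normcD _ _) _; rewrite 3!normcM normc_nat !normcX.
apply: (@le_trans _ _ (V * (j.+2%:R ^+ 2 * V ^+ j * normc (y - x) ^+ 2) +
    j.+2%:R * V ^+ j.+1 * normc (y - x) ^+ 2)).
  apply: lerD; first by apply: ler_pM; rewrite ?normc_ge0.
  by rewrite ler_wpM2r ?sqr_ge0// ler_wpM2l// lerXn2r ?nnegrE ?normc_ge0.
have -> : V * (j.+2%:R ^+ 2 * V ^+ j * normc (y - x) ^+ 2) +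
    j.+2%:R * V ^+ j.+1 * normc (y - x) ^+ 2 =
    (j.+2%:R ^+ 2 + j.+2%:R) * (V ^+ j.+1 * normc (y - x) ^+ 2).
  rewrite (exprS V j); ring.
rewrite -mulrA ler_wpM2r ?mulr_ge0 ?exprn_ge0 ?normc_ge0//.
have : 0 <= j.+2%:R :> R by [].
rewrite -[j.+3%:R]natr1; nra.
Qed.

(** With x = b / w and y = b / (w + h) one has y - x = - (h / b) x y, so the
    quadratic remainder of a power in y - x is one in h.  The two extra factors V
    it contains cancel 1 / b^2 since V <= b; the bound keeps V^(j+2), which is the
    quantity controlled on the region. *)
Lemma normc_inv_exp_taylor b w h V j : 0 < b -> w != 0 -> w + h != 0 ->
  normc (b%:C / w) <= V -> normc (b%:C / (w + h)) <= V -> V <= b ->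
  normc ((b%:C / (w + h)) ^+ j.+2 - (b%:C / w) ^+ j.+2
         - h * - (j.+2%:R / b%:C * (b%:C / w) ^+ j.+3)) <=
  2 * j.+2%:R ^+ 2 * V ^+ j.+2 * normc h ^+ 2.
Proof.
move=> b0 w0 wh0; set x := b%:C / w; set y := b%:C / (w + h) => xV yV Vb.
have V0 : 0 <= V by exact: le_trans (normc_ge0 _) xV.
have bC0 : b%:C != 0 :> R[i] by apply/eqP => -[/eqP]; rewrite gt_eqF.
have yx : y - x = - (h / b%:C) * (x * y) by rewrite /x /y; field; rewrite w0 wh0.
have -> : y ^+ j.+2 - x ^+ j.+2 - h * - (j.+2%:R / b%:C * x ^+ j.+3) =
  (y ^+ j.+2 - x ^+ j.+2 - j.+2%:R * x ^+ j.+1 * (y - x)) +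
  j.+2%:R * (h / b%:C) ^+ 2 * (x ^+ j.+3 * y).
  (* Replacing y by x in y - x = - (h / b) x y leaves a second-order error. *)
  have -> : j.+2%:R * x ^+ j.+1 * (y - x) = - (h * (j.+2%:R / b%:C * x ^+ j.+3))
     + j.+2%:R * x ^+ j.+1 * ((h / b%:C) * x * (x - y)).
    rewrite yx !exprS; field; exact: bC0.
  have -> : x - y = (h / b%:C) * (x * y) by rewrite -opprB yx mulNr opprK.
  rewrite !exprS; field; exact: bC0.
have hb : normc (h / b%:C) = normc h / b by rewrite normcM normcV normc_real gtr0_norm.
have xyV : normc (x * y) <= V ^+ 2 by rewrite normcM expr2 ler_pM ?normc_ge0.
have key : V ^+ j * (normc h / b * V ^+ 2) ^+ 2 <= V ^+ j.+2 * normc h ^+ 2.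
  have -> : V ^+ j * (normc h / b * V ^+ 2) ^+ 2 = V ^+ j.+2 * normc h ^+ 2 * (V / b) ^+ 2.
    rewrite !exprS; ring.
  rewrite ler_piMr ?(mulr_ge0 (exprn_ge0 _ V0) (sqr_ge0 _))//.
  by rewrite exprn_ile1 ?divr_ge0 ?(ltW b0)// ler_pdivrMr// mul1r.
have yxV : normc (y - x) <= normc h / b * V ^+ 2.
  by rewrite yx normcM normcN hb ler_wpM2l// divr_ge0 ?normc_ge0// ltW.
apply: le_trans (normcD _ _) _.
have -> : 2 * j.+2%:R ^+ 2 * V ^+ j.+2 * normc h ^+ 2 =
   j.+2%:R ^+ 2 * (V ^+ j.+2 * normc h ^+ 2) + j.+2%:R ^+ 2 * (V ^+ j.+2 * normc h ^+ 2).
  ring.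
apply: lerD.
  apply: le_trans (normc_exp_taylor j xV yV) _.
  rewrite -mulrA ler_wpM2l ?sqr_ge0//; apply: le_trans key.
  rewrite ler_wpM2l ?exprn_ge0// lerXn2r ?nnegrE ?normc_ge0//.
  exact: le_trans (normc_ge0 _) yxV.
rewrite 2!normcM normc_nat normcX hb normcM normcX -mulrA.
have VX n : 0 <= V ^+ n by exact: exprn_ge0.
have xX n : normc x ^+ n <= V ^+ n by rewrite lerXn2r ?nnegrE ?normc_ge0.
apply: (@le_trans _ _ (j.+2%:R * (V ^+ j.+2 * normc h ^+ 2))); last first.
  rewrite ler_wpM2r ?(mulr_ge0 (VX _) (sqr_ge0 _))//.
  by rewrite expr2 ler_peMr// ler1n.
rewrite ler_wpM2l//; apply: le_trans key.
have -> : V ^+ j * (normc h / b * V ^+ 2) ^+ 2 = (normc h / b) ^+ 2 * (V ^+ j.+3 * V).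
  rewrite !exprS; ring.
by rewrite ler_wpM2l ?sqr_ge0// ler_pM ?normc_ge0// exprn_ge0// normc_ge0.
Qed.

End PowerRemainder.

(** * Sparse scales *)

Section Scales.
Context {R : realType}.

Lemma exists_natr_ge (x : R) : exists N : nat, x <= N%:R.
Proof.
exists (Num.bound `|x|); apply: le_trans (ler_norm x) _.
by rewrite ltW// archi_boundP.
Qed.

Lemma powR_root (x q : R) : 0 < q -> 0 <= x -> (x `^ (1 / q)) `^ q = x.
Proof. by move=> q0 x0; rewrite -powRrM div1r mulVf ?gt_eqF// powRr1. Qed.

(** The scales are k n = A^(n+1) with A large.  With x = k^q, the bounds hold for
    every k >= A because k / x = k^(1-q) and exp x / k^3 tend to infinity; the last
    clause holds because passing from k m to k n multiplies k by at least A, hence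
    x by at least A^q. *)
Lemma sparse_scales (q M : R) : 0 < q -> q < 1 -> 1 <= M ->
  exists k : nat -> nat,
    [/\ forall n, M <= (k n)%:R `^ q,
        forall n, M * (k n)%:R `^ q <= (k n)%:R,
        forall n, M * (k n).+2%:R ^+ 3 <= expR ((k n)%:R `^ q),
        forall n, (2 ^ n.+1 <= k n)%N &
        forall m n, (m < n)%N ->
          (4 * k m <= k n)%N /\ M * (k m)%:R `^ q <= (k n)%:R `^ q].
Proof.
move=> q0 q1 M1; have M0 : 0 <= M by rewrite (le_trans ler01).
(* x^J bounds k^3, and one more power of x beats the constant in exp x. *)
have [J Jq] := exists_natr_ge (3 / q).
pose M' := 27 * M * (J.+1)`!%:R.
have f1 : 1 <= (J.+1)`!%:R :> R by rewrite ler1n fact_gt0.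
have MM' : M <= M' by rewrite /M' mulrAC ler_peMl//; nra.
have M'0 : 0 <= M' by exact: le_trans MM'.
have [A1 hA1] := exists_natr_ge (M' `^ (1 / q)).
have [A2 hA2] := exists_natr_ge (M `^ (1 / (1 - q))).
pose A := maxn 4 (maxn A1 A2).
have A4 : (4 <= A)%N by exact: leq_maxl.
have pw (x : R) (B : nat) (r : R) : 0 < r -> 0 <= x -> x `^ (1 / r) <= B%:R -> (B <= A)%N ->
    forall k, (A <= k)%N -> x <= k%:R `^ r.
  move=> r0 x0 xB BA k Ak; rewrite -[leLHS](powR_root r0 x0).
  apply: ge0_ler_powR; rewrite ?nnegrE ?powR_ge0 ?(ltW r0)//.
  by rewrite (le_trans xB)// ler_nat (leq_trans BA).
have e1 := pw _ _ q q0 M'0 hA1 (leq_trans (leq_maxl A1 A2) (leq_maxr 4 _)).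
have q1' : 0 < 1 - q by rewrite subr_gt0.
have e2 := pw _ _ _ q1' M0 hA2 (leq_trans (leq_maxr A1 A2) (leq_maxr 4 _)).
have A0 : (0 < A)%N by exact: leq_trans A4.
exists (fun n => A ^ n.+1)%N.
have kA n : (A <= A ^ n.+1)%N by rewrite expnS leq_pmulr// expn_gt0 A0.
have k0 n : 0 < (A ^ n.+1)%:R :> R by rewrite ltr0n expn_gt0 A0.
split.
- by move=> n; apply: le_trans MM' (e1 _ (kA n)).
- move=> n; rewrite -[leRHS]powRr1 ?ler0n//.
  have -> : (A ^ n.+1)%:R `^ 1 = (A ^ n.+1)%:R `^ (1 - q) * (A ^ n.+1)%:R `^ q :> R.
    by rewrite -powRD ?subrK// gt_eqF ?implybT.
  by rewrite ler_wpM2r ?powR_ge0// e2.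
- move=> n; set k := (A ^ n.+1)%N; set x := k%:R `^ q.
  have x1 : 1 <= x by apply: le_trans (e1 _ (kA n)); exact: le_trans M1 MM'.
  have kx : k%:R ^+ 3 <= x ^+ J.
    rewrite -!powR_mulrn ?powR_ge0//.
    have -> : k%:R `^ 3 = x `^ (3 / q) :> R.
      by rewrite /x -powRrM mulrCA divff ?mulr1// gt_eqF.
    exact: ler_powR.
  apply: le_trans (exp_term_le J.+1 (le_trans ler01 x1)).
  rewrite ler_pdivlMr ?ltr0n ?fact_gt0// (exprS x J).
  have k3 : k.+2%:R ^+ 3 <= 27 * k%:R ^+ 3 :> R.
    have -> : 27 * k%:R ^+ 3 = (3 * k%:R) ^+ 3 :> R by ring.
    rewrite lerXn2r ?nnegrE// -natrM ler_nat.
    have : (0 < k)%N by rewrite -(ltr0n R); exact: k0.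
    by clearbody k; lia.
  apply: le_trans (_ : M' * x ^+ J <= _).
    rewrite /M' [leRHS]mulrAC ler_wpM2r// (le_trans (ler_wpM2l M0 k3))//.
    by rewrite mulrCA mulrA ler_wpM2l// mulr_ge0.
  by rewrite ler_wpM2r ?exprn_ge0 ?(le_trans ler01 x1)//; exact: e1 (kA n).
- by move=> n; rewrite leq_exp2r// (leq_trans _ A4).
- move=> m n mn.
  have Akm : (A * A ^ m.+1 <= A ^ n.+1)%N by rewrite -expnS leq_exp2l// (leq_trans _ A4).
  split; first by apply: leq_trans Akm; rewrite leq_mul2r A4 orbT.
  apply: (@le_trans _ _ ((A * A ^ m.+1)%:R `^ q)).
    rewrite natrM powRM// ler_wpM2r ?powR_ge0//.
    exact: le_trans MM' (e1 _ (leqnn A)).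
  by apply: ge0_ler_powR; rewrite ?nnegrE ?(ltW q0)// ler_nat.
Qed.

End Scales.

(** * Lower bounds for the tail of a gamma kernel *)

Section LowerBounds.
Context {R : realType}.
Implicit Types (z : R[i]) (t x a : R) (k n : nat).

(** For x >= 3 k each term up to the k-th is at least three times the previous
    one, and 1/3 + 1/9 + ... = 1/2. *)
Lemma exp_partial_sum_half x k : 0 <= x -> 3 * k%:R <= x ->
  \sum_(j < k) x ^+ j / j`!%:R <= 2^-1 * (x ^+ k / k`!%:R).
Proof.
move=> x0 kx.
have : forall j, (j <= k)%N ->
    \sum_(i < j) x ^+ i / i`!%:R <= 2^-1 * (x ^+ j / j`!%:R); last exact.
elim=> [|j IH] jk; first by rewrite big_ord0 mulr_ge0// ?invr_ge0// divr_ge0// exprn_ge0.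
rewrite big_ord_recr /=.
have j1 : 0 < j.+1%:R :> R by rewrite ltr0n.
have -> : x ^+ j.+1 / j.+1`!%:R = x / j.+1%:R * (x ^+ j / j`!%:R).
  by rewrite exprS factS natrM invfM; ring.
have r0 : 0 <= x ^+ j / j`!%:R by rewrite divr_ge0 ?exprn_ge0.
have r3 : 3 <= x / j.+1%:R.
  rewrite ler_pdivlMr//; apply: le_trans kx.
  by rewrite ler_wpM2l// ler_nat.
have := IH (ltnW jk); move: (_ / j`!%:R) r0 (x / _) r3 (\sum_(i < j) _) => r r0 y y3 S HS.
nra.
Qed.

(** When |z| t is at least 3 k the last term of the sum dominates the others; it
    carries the factor Re z / |z| that an oscillating integral must lose. *)
Lemma normc_gtail_ge k z t : 0 < Re z -> 0 <= t -> 3 * k%:R <= normc z * t ->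
  2^-1 * (Re z / normc z) * (expR (- (Re z * t)) * ((Re z * t) ^+ k / k`!%:R)) <=
  (Re z / normc z) ^+ k.+1 * normc (gtail k z t).
Proof.
move=> a0 t0 kzt; set a := Re z in a0 *; set y := normc z * t in kzt.
have za : a <= normc z by apply: le_trans (normr_Re_le z); rewrite ler_norm.
have z0 : 0 < normc z by exact: lt_le_trans za.
have nt j : normc ((z * t%:C) ^+ j / j`!%:R) = y ^+ j / j`!%:R.
  by rewrite normcM normcX normcM normcV normc_nat normc_real ger0_norm.
have gt_ge : 2^-1 * (y ^+ k / k`!%:R) <= normc (\sum_(j < k.+1) (z * t%:C) ^+ j / j`!%:R).
  rewrite big_ord_recr /= addrC; apply: le_trans (normc_distD _ _).
  rewrite nt lerBrDr -lerBrDl.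
  apply: le_trans (normc_sum _ _ _) _; under eq_bigr do rewrite nt.
  apply: le_trans (exp_partial_sum_half _ kzt) _; first by rewrite mulr_ge0 ?normc_ge0.
  by move: (_ / _) => r; lra.
rewrite /gtail normcM normc_expC ReN ReMr -/a.
have aX : 0 <= (a / normc z) ^+ k.+1 by rewrite exprn_ge0// divr_ge0// ltW.
have E0 := expR_ge0 (- (a * t)).
apply: le_trans (ler_wpM2l aX (ler_wpM2l E0 gt_ge)).
rewrite le_eqVlt; apply/orP; left; apply/eqP.
rewrite /y exprS !exprMn exprVn.
have zX : normc z ^+ k != 0 by rewrite expf_neq0// gt_eqF.
have f0 : k`!%:R != 0 :> R by rewrite pnatr_eq0 -lt0n fact_gt0.
by move: (expR _) zX => E; move: (normc z ^+ k) => Z zX; clearbody a;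
  field; rewrite f0 zX gt_eqF.
Qed.

(** A weak form of Stirling's formula; the induction step amounts to
    (1 + 1/k)^(k+1) >= e. *)
Lemma stirling_lower k : (0 < k)%N ->
  expR (-1) / k%:R <= expR (- k%:R) * k%:R ^+ k / k`!%:R :> R.
Proof.
case: k => // k _; elim: k => [|k IH]; first by rewrite expr1 mulr1 factS fact0.
set n := k.+1 in IH *.
have n0 : 0 < n%:R :> R by rewrite ltr0n.
have n1 : 0 < n.+1%:R :> R by rewrite ltr0n.
have E1 : 0 < expR (-1) :> R by exact: expR_gt0.
have ratio : expR n.+1%:R^-1 <= n.+1%:R / n%:R :> R.
  rewrite -[leLHS]invrK -expRN -[leRHS]invrK lef_pV2 ?posrE ?invr_gt0 ?divr_gt0 ?expR_gt0//.
  rewrite invf_div; apply: le_trans (expR_ge1Dx _).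
  by rewrite ler_pdivrMr// mulrDl mulNr mulVf ?gt_eqF// mul1r -natr1 addrK.
have ratio1 : expR 1 <= (n.+1%:R / n%:R) ^+ n.+1 :> R.
  have -> : expR 1 = expR n.+1%:R^-1 ^+ n.+1 :> R.
    by rewrite -expRM_natl mulfV// gt_eqF.
  by rewrite lerXn2r ?nnegrE ?expR_ge0// divr_ge0.
have e1 : expR (- n.+1%:R) = expR (- n%:R) / expR 1 :> R.
  by rewrite -natr1 opprD expRD (expRN 1).
have -> : expR (- n.+1%:R) * n.+1%:R ^+ n.+1 / n.+1`!%:R =
   (expR (- n%:R) * n%:R ^+ n / n`!%:R) * (n%:R / n.+1%:R) *
   ((n.+1%:R / n%:R) ^+ n.+1 / expR 1) :> R.
  rewrite e1 factS natrM expr_div_n !exprS.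
  have f0 : n`!%:R != 0 :> R by rewrite pnatr_eq0 -lt0n fact_gt0.
  have X0 : n%:R ^+ n != 0 :> R by rewrite expf_neq0// gt_eqF.
  move: (n%:R ^+ n) X0 (expR _) (expR 1) (expR_gt0 (1 : R)) n0 n1 => P P0 E F F0 n0 n1.
  move: (n%:R) (n.+1%:R) (n`!%:R) f0 n0 n1 => u w f f0 u0 w0.
  by field; rewrite f0 ?expf_neq0 !gt_eqF.
apply: (@le_trans _ _ (expR (-1) / n%:R * (n%:R / n.+1%:R))).
  by rewrite mulrA mulfVK// gt_eqF.
rewrite -[leLHS]mulr1; apply: ler_pM => //.
- by rewrite ler_wpM2r// divr_ge0 ?ltW.
- by rewrite ler_pdivlMr ?expR_gt0// mul1r.
Qed.

Lemma poisson_mode_lower k x : (0 < k)%N -> k%:R <= x -> x <= k.+1%:R ->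
  expR (- 2) / k%:R <= expR (- x) * (x ^+ k / k`!%:R).
Proof.
move=> k0 kx xk.
have -> : expR (- 2) / k%:R = expR (-1) * (expR (-1) / k%:R) :> R.
  by rewrite mulrA -expRD; congr (expR _ / _); lra.
apply: le_trans (ler_wpM2l (expR_ge0 (-1)) (stirling_lower k0)) _.
rewrite -[X in _ * X]mulrA [leLHS]mulrA -expRD.
apply: ler_pM; rewrite ?expR_ge0 ?divr_ge0 ?exprn_ge0//.
- by rewrite ler_expR; move: xk; rewrite -natr1; lra.
- by rewrite ler_wpM2r// lerXn2r ?nnegrE// (le_trans _ kx).
Qed.

End LowerBounds.

(** * Measurability and integrability *)

Section ComplexIntegralFacts.
Context {R : realType}.
Local Notation mu := (@lebesgue_measure R).
Implicit Types (D : set R) (f g : R -> R[i]) (C t x : R) (z : R[i]) (k n : nat).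

Definition Cintegrable D f :=
  mu.-integrable D (EFin \o (Re \o f)) /\ mu.-integrable D (EFin \o (Im \o f)).

Lemma eq_Cintegral D f g : (forall t, D t -> f t = g t) ->
  Cintegral D f = Cintegral D g.
Proof.
move=> fg; congr (_ +i* _); apply: eq_Rintegral => t; rewrite inE => Dt /=.
- by rewrite fg.
- by rewrite fg.
Qed.

Lemma CintegralZl D f x : measurable D -> Cintegrable D f ->
  Cintegral D (fun t => x%:C * f t) = x%:C * Cintegral D f.
Proof.
move=> mD [iR iI]; apply: eqReIm; rewrite ?ReM ?ImM /= mul0r ?subr0 ?addr0.
- rewrite -RintegralZl//; apply: eq_Rintegral => t _.
  by rewrite /= ReM /= mul0r subr0.
- rewrite -RintegralZl//; apply: eq_Rintegral => t _.
  by rewrite /= ImM /= mul0r addr0.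
Qed.

Lemma Cintegrable_gkernel k z : 0 < Re z -> Cintegrable half_line (gkernel k z).
Proof.
move=> a0; have [mR mI] := measurable_gkernel half_line k z.
have aX : 0 < Re z ^+ k.+1 by rewrite exprn_gt0.
have bd t : half_line t -> normc (gkernel k z t) <=
    cauchy_dom ((Re z + k.+2%:R ^+ 2 / Re z) / Re z ^+ k.+1) t.
  rewrite half_lineE => t0; rewrite /cauchy_dom mulrAC ler_pdivlMr// mulrC.
  exact: normc_gkernel_le.
split; apply: dominated_integrable_fun (integrable_cauchy_dom _) _ => //.
- exact: measurable_half_line.
- by move=> t Dt; apply: le_trans (bd t Dt); exact: normr_Re_le.
- exact: measurable_half_line.
- by move=> t Dt; apply: le_trans (bd t Dt); exact: normr_Im_le.
Qed.

Lemma sub_half_line t : `[0, t] `<=` (half_line : set R).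
Proof. by move=> s /=; rewrite half_lineE in_itv/= => /andP[]. Qed.

Lemma Cintegrable_sub f t : Cintegrable half_line f -> Cintegrable `[0, t] f.
Proof.
by move=> [iR iI]; split; [apply: integrableS iR|apply: integrableS iI] => //;
  exact: sub_half_line || exact: measurable_half_line.
Qed.

Lemma measurable_csum D (u : nat -> R -> R[i]) (v : R -> R) :
  (forall n, measurable_fun D (Re \o u n)) ->
  (forall n, measurable_fun D (Im \o u n)) ->
  (forall t, D t -> geodom (v t) (u ^~ t)) ->
  measurable_fun D (Re \o (fun t => csum (u ^~ t))) /\
  measurable_fun D (Im \o (fun t => csum (u ^~ t))).
Proof.
move=> mR mI uv; split.
- apply: (measurable_fun_cvg (h := fun N t => series (Re \o u ^~ t) N)).
    by move=> N; rewrite /series /=; exact: measurable_sum.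
  by move=> t Dt; case: (geodom_is_csum (uv t Dt)).
- apply: (measurable_fun_cvg (h := fun N t => series (Im \o u ^~ t) N)).
    by move=> N; rewrite /series /=; exact: measurable_sum.
  by move=> t Dt; case: (geodom_is_csum (uv t Dt)).
Qed.

Lemma measurable_normc D f : measurable_fun D (Re \o f) -> measurable_fun D (Im \o f) ->
  measurable_fun D (normc \o f).
Proof.
move=> mR mI.
have -> : normc \o f = Num.sqrt \o (fun t => (Re \o f) t ^+ 2 + (Im \o f) t ^+ 2).
  by apply/funext => t /=; case: (f t).
apply: measurableT_comp.
  by apply: continuous_measurable_fun; exact: sqrt_continuous.
by apply: measurable_funD; apply: measurable_funX.
Qed.

Lemma Cderive_measurable D f (d : R -> R[i]) : (forall t, is_Cderive f t (d t)) ->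
  measurable_fun D (Re \o f) /\ measurable_fun D (Im \o f).
Proof.
by move=> df; split; apply: measurable_funTS; apply: continuous_measurable_fun => t;
  have [] := Cderive_continuous (df t).
Qed.

Lemma Lp_of_cauchy_dom (p : R) f C : 1 <= p ->
  measurable_fun half_line (Re \o f) -> measurable_fun half_line (Im \o f) ->
  (forall t, 0 <= t -> normc (f t) <= cauchy_dom C t) -> Lp_half_line p f.
Proof.
move=> p1 mR mI fC; split=> //.
have C0 : 0 <= C.
  have := le_trans (normc_ge0 _) (fC 0 (lexx 0)).
  by rewrite /cauchy_dom expr0n addr0 divr1.
apply: le_lt_trans (integrable_lty _ (integrable_cauchy_dom (C `^ p)));
  last exact: measurable_half_line.
apply: ge0_le_integral => //.
- exact: measurable_half_line.
- by move=> t _; rewrite lee_fin powR_ge0.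
- apply/measurable_EFinP; apply: (@measurableT_comp _ _ _ _ _ _ (@powR R ^~ p)).
    exact: measurable_powR.
  exact: measurable_normc.
- by have /integrableP[] := integrable_cauchy_dom (C `^ p).
- move=> t; rewrite half_lineE => t0; rewrite lee_fin.
  have d1 : 1 <= 1 + t ^+ 2 by rewrite lerDl sqr_ge0.
  have d0 : 0 < 1 + t ^+ 2 by exact: lt_le_trans d1.
  apply: (@le_trans _ _ (cauchy_dom C t `^ p)).
    apply: ge0_ler_powR; rewrite ?nnegrE ?normc_ge0 ?(le_trans ler01 p1)//.
      by rewrite divr_ge0// ltW.
    exact: fC.
  rewrite /cauchy_dom powRM ?invr_ge0 ?(ltW d0)//.
  rewrite ler_wpM2l ?powR_ge0// ge1r_powR//.
  by rewrite invr_gt0 d0/= invf_le1.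
Qed.

End ComplexIntegralFacts.

(** * The logarithmic region *)

Section Region.
Context {R : realType}.
Implicit Types (z h : R[i]) (alpha y : R).

Lemma lnC_gt0 y : 0 < ln (2 + `|y|).
Proof. by rewrite ln_gt0//; have := normr_ge0 y; lra. Qed.

(** The boundary is the graph of a continuous function of the imaginary part. *)
Lemma log_region_open alpha z : log_region alpha z ->
  exists2 r, 0 < r & forall h, normc h < r -> log_region alpha (z + h).
Proof.
rewrite /log_region /= => zO.
pose phi y := - 1 / ln (2 + `|y|) `^ alpha.
have phiE : phi = (fun y => - expR (- (alpha * ln (ln (2 + `|y|))))).
  by apply/funext => y; rewrite /phi /powR gt_eqF ?lnC_gt0// mulN1r expRN.
have cphi : {for Im z, continuous phi}.
  rewrite phiE; apply: cvgN; apply: continuous_comp; last exact: continuous_expR.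
  apply: cvgN; apply: cvgMl_tmp; apply: continuous_comp; last exact/continuous_ln/lnC_gt0.
  apply: continuous_comp; last by apply: continuous_ln; rewrite ltr_pwDl.
  by apply: cvgD; [exact: cvg_cst|exact: norm_continuous].
pose d := Re z - phi (Im z).
have d0 : 0 < d / 2 by rewrite divr_gt0// subr_gt0.
have /cvgrPdist_lt/(_ _ d0)/nbhs_ballP[e /= e0 He] := cphi.
exists (Num.min e (d / 2)); first by rewrite lt_min e0 d0.
move=> h; rewrite lt_min => /andP[he hd].
have hI := normr_Im_le h; have hR := normr_Re_le h.
have := He (Im (z + h)); rewrite /ball/= ImD opprD addrA subrr add0r normrN.
move=> /(_ (le_lt_trans hI he)); rewrite -/(phi _) ReD.
rewrite ltr_norml => /andP[+ _]; move: hR; rewrite ler_norml => /andP[+ _].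
by rewrite /d in hd *; lra.
Qed.

End Region.

(** * The lacunary wave *)

(** The parameters follow the notation of the opening comment, with X n the
    quantity x = k^(1/(alpha+1)) at k = k n, and M the constant that makes the
    scales sparse enough. *)
Section Construction.
Context {R : realType}.
Local Notation mu := (@lebesgue_measure R).
Context (alpha b K M : R) (k : nat -> nat) (X : nat -> R).
Implicit Types (z w h : R[i]) (t : R) (n m : nat).
Context (alpha0 : 0 < alpha) (b1 : 1 <= b) (bln : 1 / ln 2 `^ alpha <= b - 1).
Context (KE : K = 4 * 2 `^ alpha + 2).
Context (M4b : 4 * b <= M) (Malpha : 2 * 2 `^ (1 / alpha) <= M).
Context (MK : 4 * (K + 3) <= M) (Me : 4 * expR 2 <= M).
Context (kX : forall n, (k n)%:R = X n `^ (alpha + 1)).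
Context (XM : forall n, M <= X n) (XMk : forall n, M * X n <= (k n)%:R).
Context (eXk : forall n, M * (k n).+2%:R ^+ 3 <= expR (X n)).
Context (k2 : forall n, (2 ^ n.+1 <= k n)%N).
Context (kk : forall m n, (m < n)%N -> (4 * k m <= k n)%N /\ M * X m <= X n).

Let b0 : 0 < b. Proof. exact: lt_le_trans b1. Qed.
Let M4 : 4 <= M. Proof. by apply: le_trans M4b; have := b1; lra. Qed.
Let X4 n : 4 <= X n. Proof. exact: le_trans M4 (XM n). Qed.
Let X0 n : 0 < X n. Proof. by apply: lt_le_trans (X4 n). Qed.
Let K2 : 2 <= K. Proof. by rewrite KE; have := powR_ge0 2 alpha; lra. Qed.
Let k0 n : (0 < k n)%N. Proof. by apply: leq_trans (k2 n); rewrite expn_gt0. Qed.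

Definition freq n : R := expR (X n).
(** The complex decay rate b - i w of the n-th packet. *)
Definition rate n : R[i] := b +i* (- freq n).
Definition coef n : R := expR (- (K * X n)).

Definition transform_term n z : R[i] :=
  (coef n)%:C * (b%:C / (z + rate n)) ^+ (k n).+1.
Definition transform z : R[i] := csum (fun n => transform_term n z).
Definition wave_term n t : R[i] := (coef n * b ^+ (k n).+1)%:C * gkernel (k n) (rate n) t.
Definition wave t : R[i] := csum (fun n => wave_term n t).

Lemma M_le_freq n : M <= freq n.
Proof.
apply: le_trans (XM n) _; apply: le_trans (expR_ge1Dx _).
by rewrite lerDr.
Qed.

(** The polynomial factors in k caused by differentiation and by the majorant of
    the packets are absorbed here, together with the summability in n. *)
Lemma weight_le n : (k n).+2%:R ^+ 2 * expR (- X n) <= 1 / 2 ^+ n.+1.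
Proof.
have e := eXk n; have E0 := expR_gt0 (X n).
have q0 : 0 < (k n).+2%:R :> R by rewrite ltr0n.
rewrite expRN ler_pdivrMr// mulrAC mul1r ler_pdivlMr ?exprn_gt0//.
apply: le_trans (_ : (k n).+2%:R ^+ 3 <= _); last first.
  apply: le_trans e; rewrite ler_peMl ?exprn_ge0 ?(ltW q0)//; have := M4; lra.
rewrite [leRHS]exprSr ler_wpM2l ?sqr_ge0// -natrX ler_nat.
by apply: leq_trans (k2 n) _; exact/leqW/leqW.
Qed.

Lemma coef_le n : coef n <= expR (- (2 * X n)).
Proof. by rewrite ler_expR lerN2 ler_wpM2r// ltW. Qed.

Lemma expRN2_le n (c : R) : 0 <= c -> c <= (k n).+2%:R ^+ 2 ->
  expR (- (2 * X n)) * c <= 1 / 2 ^+ n.+1.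
Proof.
move=> c0 ck; apply: le_trans (weight_le n).
rewrite mulrC; apply: ler_pM; rewrite ?expR_ge0//.
by rewrite ler_expR; have := X0 n; lra.
Qed.

Lemma region_Re z : log_region alpha z -> 1 <= Re z + b.
Proof.
rewrite /log_region/= => zO.
have l2 : 0 < ln 2 :> R by rewrite ln_gt0// ltr1n.
have : 1 / ln (2 + `|Im z|) `^ alpha <= 1 / ln 2 `^ alpha.
  rewrite ler_pM2l// lef_pV2 ?posrE ?powR_gt0 ?lnC_gt0//.
  apply: ge0_ler_powR; rewrite ?nnegrE ?(ltW alpha0) ?(ltW l2) ?(ltW (lnC_gt0 _))//.
  by rewrite ler_ln ?posrE ?lerDl// ltr_pwDl.
by have := bln; move: zO; rewrite mulN1r !div1r; lra.
Qed.

Lemma Re_rate z n : Re (z + rate n) = Re z + b.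
Proof. by rewrite ReD. Qed.

Lemma shifted_neq0 z n : 0 < Re z + b -> z + rate n != 0.
Proof.
move=> h; apply/eqP => /(congr1 (@complex.Re R)).
by rewrite Re_rate/= => e; rewrite e ltxx in h.
Qed.

Lemma ratio_le_b z n : 1 <= Re z + b -> normc (b%:C / (z + rate n)) <= b.
Proof.
move=> h; rewrite normcM normcV normc_real gtr0_norm//.
have n1 : 1 <= normc (z + rate n).
  by apply: le_trans (normr_Re_le _); rewrite Re_rate; apply: le_trans (ler_norm _).
by rewrite ler_piMr ?(ltW b0)// invf_le1// (lt_le_trans ltr01).
Qed.

(** Below half the frequency the base of the power has modulus at most 1, however
    far left z lies.  Above it, Re z >= - s with s = (2/X)^alpha, and the power
    k+1 produces exp (O(s k)) = exp (O(X)). *)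
Lemma region_bound z n : log_region alpha z ->
  coef n * normc (b%:C / (z + rate n)) ^+ (k n).+1 <= expR (- (2 * X n)).
Proof.
move=> zO; have zb := region_Re zO.
have w0 := normc_gt0 (shifted_neq0 n (lt_le_trans ltr01 zb)).
rewrite normcM normcV normc_real gtr0_norm//.
have [near0|far0] := leP `|Im z| (freq n / 2).
  have big : b <= normc (z + rate n).
    apply: le_trans (normr_Im_le _); rewrite ImD/= -normrN opprB.
    apply: le_trans (lerB_dist _ _); rewrite [`|freq n|]ger0_norm ?expR_ge0//.
    by have := M_le_freq n; have := M4b; have := b1; lra.
  rewrite -[leRHS]mulr1; apply: ler_pM;
    rewrite ?expR_ge0 ?exprn_ge0 ?divr_ge0 ?(ltW b0) ?normc_ge0 ?coef_le//.
  by rewrite exprn_ile1 ?divr_ge0 ?(ltW b0) ?normc_ge0// ler_pdivrMr// mul1r.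
pose s := 1 / (X n / 2) `^ alpha.
have Xh0 : 0 < X n / 2 by rewrite divr_gt0.
have s0 : 0 < s by rewrite divr_gt0// powR_gt0.
have s2 : s <= 2^-1.
  rewrite /s div1r lef_pV2 ?posrE ?powR_gt0//.
  rewrite -[leLHS](powR_root alpha0)//; apply: ge0_ler_powR;
    rewrite ?nnegrE ?powR_ge0 ?(ltW alpha0) ?(ltW Xh0)//.
  by have := XM n; have := Malpha; lra.
(* The loss of half of X absorbs the ln 2 of freq n / 2. *)
have lnX : X n / 2 <= ln (2 + `|Im z|).
  have : ln (freq n / 2) <= ln (2 + `|Im z|).
    rewrite ler_ln ?posrE ?divr_gt0 ?expR_gt0 ?ltr_pwDl//; lra.
  rewrite ln_div ?posrE ?expR_gt0// expRK.
  have : ln (1 + 1) <= 1 :> R by apply: le_ln1Dx; lra.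
  by have := X4 n; have -> : 1 + 1 = 2 :> R by []; lra.
have Rez : - s <= Re z.
  apply: ltW; apply: le_lt_trans zO; rewrite mulN1r lerN2 -div1r /s.
  rewrite ler_pM2l// lef_pV2 ?posrE ?powR_gt0 ?lnC_gt0//.
  by apply: ge0_ler_powR; rewrite ?nnegrE ?(ltW alpha0) ?(ltW Xh0) ?(ltW (lnC_gt0 _)).
have ratio : b / normc (z + rate n) <= expR (2 * s).
  apply: le_trans (expR_ge1Dx _); rewrite ler_pdivrMr//.
  have : b - s <= normc (z + rate n).
    apply: le_trans (normr_Re_le _); rewrite Re_rate; apply: le_trans (ler_norm _); lra.
  by have := b1; move: (normc _) => N; nra.
have pow : (b / normc (z + rate n)) ^+ (k n).+1 <= expR (4 * 2 `^ alpha * X n).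
  apply: (@le_trans _ _ (expR (2 * s) ^+ (k n).+1)).
    by rewrite lerXn2r ?nnegrE ?expR_ge0// divr_ge0 ?(ltW b0) ?normc_ge0.
  rewrite -expRM_natl ler_expR.
  have sk : s * (k n)%:R = 2 `^ alpha * X n.
    rewrite /s kX powRM ?invr_ge0 ?(ltW (X0 n))// powRD; last by rewrite (gt_eqF (X0 n)) implybT.
    have -> : 2^-1 `^ alpha = (2 `^ alpha)^-1 :> R 
      by rewrite -(powR_inv1 (ler0n R 2)) powRAC powR_inv1 ?powR_ge0.
    rewrite powRr1 ?(ltW (X0 n))//.
    have := powR_gt0 alpha (X0 n); have : 0 < 2 `^ alpha :> R by rewrite powR_gt0.
    by move: (2 `^ alpha) (X n `^ alpha) => u v u0 v0; field; rewrite !gt_eqF.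
  have k1 : 1 <= (k n)%:R :> R by rewrite ler1n.
  by rewrite -natr1; nra.
apply: (@le_trans _ _ (coef n * expR (4 * 2 `^ alpha * X n))).
  by rewrite ler_wpM2l ?expR_ge0.
by rewrite -expRD ler_expR KE; lra.
Qed.

Lemma coef_ge0 n : 0 <= coef n. Proof. exact: expR_ge0. Qed.

Lemma normc_transform_term n z :
  normc (transform_term n z) = coef n * normc (b%:C / (z + rate n)) ^+ (k n).+1.
Proof. by rewrite /transform_term normcM normc_real ger0_norm ?coef_ge0// normcX. Qed.

Lemma transform_geodom z : log_region alpha z -> geodom 1 (fun n => transform_term n z).
Proof.
move=> zO n; rewrite normc_transform_term; apply: le_trans (region_bound n zO) _.
rewrite -[leLHS]mulr1; apply: expRN2_le => //.
by rewrite expr_ge1// ler1n.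
Qed.

Lemma transform_bounded z : log_region alpha z -> normc (transform z) <= 2.
Proof. by move=> zO; have := csum_le (transform_geodom zO); rewrite mulr1. Qed.

Lemma ler_piMr_trans (x y c : R) : x <= c -> 0 <= x -> y <= 1 -> x * y <= c.
Proof. by move=> xc x0 y1; apply: le_trans xc; rewrite ler_piMr. Qed.

(** The region is open and [region_bound] holds on all of it, so the Taylor
    remainders at z have a uniform summable majorant on a small disc. *)
Lemma transform_holomorphic : holomorphic_on (log_region alpha) transform.
Proof.
move=> z zO; have [r r0 rO] := log_region_open zO.
pose x n := b%:C / (z + rate n).
pose u n := (coef n)%:C * - ((k n).+1%:R / b%:C * x n ^+ (k n).+2).
have zb := region_Re zO.
have xb n : normc (x n) <= b by exact: ratio_le_b.
have z0 n : z + rate n != 0 by apply: shifted_neq0; exact: lt_le_trans zb.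
have j1 n : 1 <= (k n).+1%:R :> R by rewrite ler1n.
have jj n : (k n).+1%:R ^+ 2 <= (k n).+2%:R ^+ 2 :> R by rewrite lerXn2r ?nnegrE// ler_nat.
have j2 n : (k n).+1%:R <= (k n).+2%:R ^+ 2 :> R.
  by apply: le_trans (jj n); rewrite expr2 ler_peMl// (le_trans ler01).
apply: (@derivable_csum _ transform_term u z r 2 r0).
- move=> n; rewrite /u normcM normc_real ger0_norm ?coef_ge0// normcN normcM normcX.
  rewrite normcM normcV normc_nat normc_real gtr0_norm//.
  apply: (@le_trans _ _ (expR (- (2 * X n)) * (k n).+1%:R)).
    have -> : coef n * ((k n).+1%:R / b * normc (x n) ^+ (k n).+2) =
       (coef n * normc (x n) ^+ (k n).+1) * (k n).+1%:R * (normc (x n) / b).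
      by rewrite exprS; ring.
    apply: ler_piMr_trans; last by rewrite ler_pdivrMr// mul1r.
      by rewrite ler_wpM2r//; exact: region_bound.
    by rewrite mulr_ge0// mulr_ge0 ?coef_ge0// exprn_ge0// normc_ge0.
  apply: le_trans (expRN2_le _ (j2 n)) _ => //.
  by rewrite ler_wpM2r ?invr_ge0 ?exprn_ge0// ler1n.
- move=> h hr n; apply: le_trans (transform_geodom (rO h hr) n) _.
  by rewrite ler_wpM2r ?invr_ge0 ?exprn_ge0// ler1n.
- move=> h hr n; have zhO := rO h hr; have zhb := region_Re zhO.
  pose y := b%:C / (z + rate n + h).
  have zhE : z + h + rate n = z + rate n + h by rewrite addrAC.
  have zh0 : z + rate n + h != 0.
    by rewrite -zhE; apply: shifted_neq0; exact: lt_le_trans zhb.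
  pose V := Num.max (normc (x n)) (normc y).
  have Vb : V <= b by rewrite ge_max xb /y -zhE ratio_le_b.
  have xV : normc (x n) <= V by rewrite le_max lexx.
  have yV : normc y <= V by rewrite le_max lexx orbT.
  have VE : coef n * V ^+ (k n).+1 <= expR (- (2 * X n)).
    rewrite /V; case: (leP (normc (x n)) (normc y)) => _; last exact: region_bound.
    by rewrite /y -zhE; exact: region_bound.
  (* The Taylor remainder needs an exponent of at least 2, that is k n > 0. *)
  have kE : (k n).+1 = (k n).-1.+2 by rewrite prednK.
  rewrite /transform_term /u zhE -/y -/(x n).
  have -> : (coef n)%:C * y ^+ (k n).+1 - (coef n)%:C * x n ^+ (k n).+1
       - h * ((coef n)%:C * - ((k n).+1%:R / b%:C * x n ^+ (k n).+2)) =
     (coef n)%:C * (y ^+ (k n).+1 - x n ^+ (k n).+1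
       - h * - ((k n).+1%:R / b%:C * x n ^+ (k n).+2)) by ring.
  rewrite normcM normc_real ger0_norm ?coef_ge0//.
  have := normc_inv_exp_taylor (k n).-1 b0 (z0 n) zh0 xV yV Vb.
  rewrite -kE -/y -/(x n) => /(ler_wpM2l (coef_ge0 n)) /le_trans; apply.
  have -> : coef n * (2 * (k n).+1%:R ^+ 2 * V ^+ (k n).+1 * normc h ^+ 2) =
    (coef n * V ^+ (k n).+1) * (k n).+1%:R ^+ 2 * (2 * normc h ^+ 2) by ring.
  rewrite [leLHS]mulrC ler_wpM2l ?(mulr_ge0 (ler0n R 2) (sqr_ge0 (normc h)))//.
  rewrite -div1r; apply: le_trans (expRN2_le (sqr_ge0 _) (jj n)).
  by rewrite ler_wpM2r ?sqr_ge0.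
Qed.

Lemma rate_Re n : Re (rate n) = b. Proof. by []. Qed.

Lemma wave_geodom t : 0 <= t -> geodom (cauchy_dom (2 * b) t) (fun n => wave_term n t).
Proof.
move=> t0 n; rewrite /wave_term normcM normc_real ger0_norm; last first.
  by rewrite mulr_ge0 ?coef_ge0 ?exprn_ge0 ?(ltW b0).
have d0 : 0 < 1 + t ^+ 2 by rewrite ltr_pwDl// sqr_ge0.
rewrite /cauchy_dom [leRHS]mulrAC ler_pdivlMr//.
have := normc_gkernel_le (k n) (z := rate n) (t := t) b0 t0.
rewrite rate_Re ler_pdivlMr// => /(ler_wpM2l (coef_ge0 n)).
rewrite !mulrA => /le_trans; apply.
apply: (@le_trans _ _ (expR (- (2 * X n)) * (k n).+2%:R ^+ 2 * (2 * b))).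
  rewrite -mulrA; apply: ler_pM; rewrite ?coef_ge0 ?coef_le//.
    by rewrite addr_ge0 ?(ltW b0)// divr_ge0 ?sqr_ge0 ?(ltW b0).
  have q1 : 1 <= (k n).+2%:R ^+ 2 :> R by rewrite expr_ge1// ler1n.
  have : (k n).+2%:R ^+ 2 / b <= (k n).+2%:R ^+ 2.
    by rewrite ler_piMr ?sqr_ge0// invf_le1.
  move=> ub; have -> : (k n).+2%:R ^+ 2 * (2 * b) =
    (k n).+2%:R ^+ 2 * b + (k n).+2%:R ^+ 2 * b by ring.
  by rewrite lerD ?ler_peMl ?(ltW b0)// (le_trans ub)// ler_peMr ?sqr_ge0.
rewrite [leRHS]mulrC -div1r.
rewrite ler_wpM2r ?mulr_ge0 ?(ltW b0)//.
by apply: expRN2_le; rewrite ?sqr_ge0.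
Qed.

Lemma measurable_wave_term D n :
  measurable_fun D (Re \o wave_term n) /\ measurable_fun D (Im \o wave_term n).
Proof.
have dw t : exists d, is_Cderive (wave_term n) t d.
  have [d dk] := is_Cderive_gkernel (k n) (rate n) t.
  by eexists; exact: is_CderiveM (is_Cderive_cst _ t) dk.
by have [d dE] := choice dw; exact: Cderive_measurable dE.
Qed.

Lemma measurable_wave : measurable_fun half_line (Re \o wave) /\
  measurable_fun half_line (Im \o wave).
Proof.
apply: (measurable_csum (v := cauchy_dom (2 * b))) => [n|n|t].
- by case: (measurable_wave_term half_line n).
- by case: (measurable_wave_term half_line n).
- by rewrite half_lineE; exact: wave_geodom.
Qed.

Lemma wave_Lp (p : R) : 1 <= p -> Lp_half_line p wave.
Proof.
move=> p1; have [mR mI] := measurable_wave.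
apply: (@Lp_of_cauchy_dom _ _ _ (2 * (2 * b))) => // t t0.
by have := csum_le (wave_geodom t0); rewrite /cauchy_dom mulrA.
Qed.

Lemma gkernel_shift m z w t : expC (- (z * t%:C)) * gkernel m w t = gkernel m (z + w) t.
Proof.
by rewrite /gkernel mulrCA -expCD; congr (_ * expC _); ring.
Qed.

(** Multiplication by exp (- z t) shifts the decay rate of each packet by z. *)
Lemma laplace_wave z : 0 < Re z -> transform z = laplace wave z.
Proof.
move=> z0; have zb : 0 < Re z + b by rewrite addr_gt0.
have rp n : 0 < Re (z + rate n) by rewrite Re_rate.
pose U n t := expC (- (z * t%:C)) * wave_term n t.
have UE n t : U n t = (coef n * b ^+ (k n).+1)%:C * gkernel (k n) (z + rate n) t.
  by rewrite -gkernel_shift /U /wave_term mulrCA.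
have mU n : measurable_fun half_line (Re \o U n) /\ measurable_fun half_line (Im \o U n).
  have dU t : exists d, is_Cderive (U n) t d.
    have [d dk] := is_Cderive_gkernel (k n) (z + rate n) t; eexists.
    have -> : U n = (fun t => (coef n * b ^+ (k n).+1)%:C * gkernel (k n) (z + rate n) t).
      by apply/funext => s; exact: UE.
    exact: is_CderiveM (is_Cderive_cst _ t) dk.
  by have [d dE] := choice dU; exact: Cderive_measurable dE.
rewrite /laplace; have -> : Cintegral half_line (fun t => expC (- (z * t%:C)) * wave t) =
    Cintegral half_line (fun t => csum (U ^~ t)).
  apply: eq_Cintegral => t; rewrite half_lineE => t0.
  exact/esym/(is_csum_eq (is_csumM _ (geodom_is_csum (wave_geodom t0)))).
rewrite (Cintegral_csum (v := cauchy_dom (2 * b))).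
- rewrite /transform; congr csum; apply/funext => n.
  have -> : U n = (fun t => (coef n * b ^+ (k n).+1)%:C * gkernel (k n) (z + rate n) t).
    by apply/funext => t; exact: UE.
  rewrite CintegralZl; [|exact: measurable_half_line|exact: Cintegrable_gkernel].
  rewrite Cintegral_gkernel_half_line// /transform_term expr_div_n.
  by rewrite rmorphM/= rmorphXn/= mulrA.
- exact: measurable_half_line.
- by move=> n; case: (mU n).
- by move=> n; case: (mU n).
- exact: integrable_cauchy_dom.
- move=> t; rewrite half_lineE => t0 n; apply: le_trans (wave_geodom t0 n).
  rewrite /U normcM normc_expC ReN ReMr ler_piMl ?normc_ge0//.
  by rewrite expR_le1 oppr_le0 mulr_ge0// ltW.
Qed.

Definition tail_term n t : R[i] :=
  (coef n)%:C * (b%:C / rate n) ^+ (k n).+1 * gtail (k n) (rate n) t.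

Lemma rate_neq0 n : rate n != 0.
Proof. by apply/eqP => /(congr1 (@complex.Re R)) /= e; move: b0; rewrite e ltxx. Qed.

Lemma normc_tail_term n t : normc (tail_term n t) =
  coef n * ((b / normc (rate n)) ^+ (k n).+1 * normc (gtail (k n) (rate n) t)).
Proof.
rewrite /tail_term; move: (gtail _ _ _) => G.
rewrite !normcM normc_real ger0_norm ?coef_ge0// normcX normcM normcV.
by rewrite normc_real gtr0_norm// mulrA.
Qed.

Lemma tail_term_le_coef n t : 0 <= t -> normc (tail_term n t) <= coef n.
Proof.
move=> t0; rewrite normc_tail_term ler_piMr ?coef_ge0//.
exact: (normc_gtail_le1 (k n) (z := rate n) b0 t0).
Qed.

Lemma coef_geo n : coef n <= 1 / 2 ^+ n.+1.
Proof.
apply: le_trans (coef_le n) _; rewrite -[leLHS]mulr1; apply: expRN2_le => //.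
by rewrite expr_ge1// ler1n.
Qed.

Lemma tail_geodom t : 0 <= t -> geodom 1 (fun n => tail_term n t).
Proof. by move=> t0 n; apply: le_trans (tail_term_le_coef n t0) (coef_geo n). Qed.

Lemma wave_tailE t : 0 <= t ->
  transform 0 - Cintegral `[0, t] wave = csum (fun n => tail_term n t).
Proof.
move=> t0; rewrite /wave (Cintegral_csum (v := cauchy_dom (2 * b))); last 5 first.
- exact: measurable_itv.
- by move=> n; case: (measurable_wave_term `[0, t] n).
- by move=> n; case: (measurable_wave_term `[0, t] n).
- have iv := integrable_cauchy_dom (2 * b).
  apply: integrableS iv; [exact: measurable_half_line|exact: measurable_itv|].
  exact: sub_half_line.
- by move=> s /sub_half_line; rewrite half_lineE; exact: wave_geodom.
have IE n : Cintegral `[0, t] (wave_term n) = transform_term n 0 - tail_term n t.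
  rewrite /wave_term CintegralZl; [|exact: measurable_itv|]; last first.
    by apply: Cintegrable_sub; apply: Cintegrable_gkernel.
  rewrite Cintegral_gkernel ?rate_neq0// /transform_term /tail_term add0r expr_div_n.
  rewrite rmorphM/= rmorphXn/=; ring.
have z0 : log_region alpha (0 : R[i]).
  by rewrite /log_region/= mulN1r oppr_lt0 invr_gt0 powR_gt0// lnC_gt0.
have -> : (fun n => Cintegral `[0, t] (wave_term n)) =
    (fun n => transform_term n 0 - tail_term n t).
  by apply/funext => n; exact: IE.
have trC := geodom_is_csum (transform_geodom z0).
rewrite (is_csum_eq (is_csumB trC (geodom_is_csum (tail_geodom t0)))).
by rewrite opprB addrC subrK.
Qed.

(** Near its peak the packet still has density at least e^-2 / k, relative to b, and the
    oscillation costs the factor b / |b - i w| >= exp (- X) / 2. *)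
Lemma tail_term_ge n t : (k n)%:R / b <= t -> t <= (k n).+1%:R / b ->
  expR (- ((K + 2) * X n)) <= normc (tail_term n t).
Proof.
rewrite ler_pdivrMr// ler_pdivlMr// [t * b]mulrC => kt tk.
have kn0 : 0 < (k n)%:R :> R by rewrite ltr0n.
have t0 : 0 <= t by rewrite -(pmulr_rge0 _ b0) (le_trans _ kt).
have fM := M_le_freq n; have f0 : 0 < freq n by exact: expR_gt0.
have fle : freq n <= normc (rate n).
  by apply: le_trans (normr_Im_le _); rewrite /= normrN ler_norm.
have ple : normc (rate n) <= 2 * freq n.
  apply: le_trans (normc_le_Re_Im _) _ => /=.
  rewrite normrN gtr0_norm// gtr0_norm//.
  by have := M4b; have := b1; lra.
have p0 : 0 < normc (rate n) by exact: lt_le_trans fle.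
have k3 : 3 * (k n)%:R <= normc (rate n) * t.
  apply: (@le_trans _ _ (3 * (b * t))); first by rewrite ler_wpM2l.
  rewrite mulrA ler_wpM2r//; apply: le_trans fle.
  by have := M4b; have := b1; lra.
rewrite normc_tail_term.
have := normc_gtail_ge (k := k n) (z := rate n) b0 t0 k3.
move=> /(ler_wpM2l (coef_ge0 n)); rewrite rate_Re; apply: le_trans.
have pm := poisson_mode_lower (k0 n) kt tk.
have bp : expR (- X n) / 2 <= b / normc (rate n).
  rewrite ler_pdivlMr// expRN -/(freq n) mulrAC ler_pdivrMr//.
  have : (freq n)^-1 * normc (rate n) <= 2.
    by rewrite mulrC ler_pdivrMr.
  by have := b1; lra.
have e4 : expR (- X n) <= 2^-1 * 2^-1 * (expR (- 2) / (k n)%:R).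
  rewrite !expRN -!invfM lef_pV2 ?posrE ?mulr_gt0 ?expR_gt0//.
  have q1 : (k n)%:R <= (k n).+2%:R ^+ 3 :> R.
    apply: (@le_trans _ _ (k n).+2%:R); first by rewrite ler_nat; exact/leqW/leqW.
    by rewrite exprS ler_peMr// expr_ge1// ler1n.
  apply: le_trans (eXk n); have := Me; have := expR_gt0 (2 : R).
  have := X0 n; move: (expR 2) (_ ^+ 3) q1 => E Q q1 _ E0 EM.
  apply: (@le_trans _ _ (4 * E * (k n)%:R)); first by rewrite -natrM; lra.
  by apply: ler_pM => //; rewrite ?mulr_ge0// ltW.
have -> : expR (- ((K + 2) * X n)) = coef n * (expR (- X n) * expR (- X n)).
  by rewrite -!expRD; congr expR; ring.
rewrite ler_wpM2l ?coef_ge0//.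
apply: (@le_trans _ _ (2^-1 * (expR (- X n) / 2) * (expR (- 2) / (k n)%:R))).
  have -> : 2^-1 * (expR (- X n) / 2) * (expR (- 2) / (k n)%:R) =
     expR (- X n) * (2^-1 * 2^-1 * (expR (- 2) / (k n)%:R)) by ring.
  by rewrite ler_wpM2l ?expR_ge0.
rewrite -[leRHS]mulrA -[leLHS]mulrA ler_wpM2l ?invr_ge0//.
by apply: ler_pM => //; rewrite divr_ge0 ?expR_ge0.
Qed.

(** The n-th packet dominates at its own peak: the earlier ones have decayed like
    exp (- k/4), and the later ones have an amplitude at most exp (- (K+3) X). *)
Lemma tail_ge n t : (k n)%:R / b <= t -> t <= (k n).+1%:R / b ->
  expR (- ((K + 3) * X n)) <= normc (transform 0 - Cintegral `[0, t] wave).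
Proof.
move=> kt tk.
have t0 : 0 <= t by apply: le_trans kt; rewrite divr_ge0// ltW.
rewrite wave_tailE//.
pose eps := expR (- ((K + 3) * X n)).
have rest : geodom eps (fun m => if m == n then 0 else tail_term m t).
  move=> m; case: (ltngtP m n) => [mn|nm|_]; last first.
  - by rewrite normc0 divr_ge0 ?expR_ge0 ?exprn_ge0.
  (* Later packets: X m >= M X n makes the amplitude itself negligible. *)
  - have [_ MX] := kk nm.
    apply: le_trans (tail_term_le_coef m t0) _.
    have -> : coef m = expR (- ((K - 1) * X m)) * expR (- X m).
      by rewrite -expRD; congr expR; ring.
    apply: ler_pM; rewrite ?expR_ge0//.
      rewrite ler_expR lerN2.
      have XX : (K + 3) * X n <= X m.
        apply: le_trans MX; rewrite ler_wpM2r ?(ltW (X0 n))//.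
        by have := MK; have := K2; lra.
      apply: (le_trans XX); rewrite ler_peMl ?(ltW (X0 m))//.
      by have := K2; lra.
    have := weight_le m; rewrite div1r; apply: le_trans.
    by rewrite ler_peMl ?expR_ge0// expr_ge1// ler1n.
  (* Earlier packets: 2^(k m) <= exp (k n / 4) against exp (- k n / 2). *)
  - have [k4 _] := kk mn.
    rewrite normc_tail_term.
    have le2 := normc_gtail_le_expR (k m) (z := rate m) b0 t0.
    apply: (@le_trans _ _ (coef m * eps)); last first.
      rewrite mulrC ler_wpM2l ?expR_ge0//.
      by rewrite -div1r; exact: coef_geo.
    rewrite ler_wpM2l ?coef_ge0//; apply: (le_trans le2).
    apply: (@le_trans _ _ (expR (k m)%:R * expR (- (b * t / 2)))).
      rewrite ler_wpM2r ?expR_ge0// -[(k m)%:R]mulr1 expRM_natl.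
      rewrite lerXn2r ?nnegrE ?expR_ge0//.
      by apply: le_trans (expR_ge1Dx 1); lra.
    rewrite -expRD ler_expR.
    have k4R : 4 * (k m)%:R <= (k n)%:R :> R by rewrite -natrM ler_nat.
    have btk : (k n)%:R <= b * t by rewrite mulrC -ler_pdivrMr.
    have : 4 * (K + 3) * X n <= (k n)%:R.
      by apply: le_trans (XMk n); rewrite ler_wpM2r ?(ltW (X0 n)).
    lra.
have := csum_ge_single rest; apply: le_trans.
rewrite lerBrDr -/eps; apply: le_trans (tail_term_ge kt tk).
have -> : expR (- ((K + 2) * X n)) = eps * expR (X n).
  by rewrite -expRD; congr expR; ring.
have e4 : 4 <= expR (X n) by apply: le_trans M4 (M_le_freq n).
have e0 : 0 <= eps by exact: expR_ge0.
move: (expR (X n)) e4 => E e4; nra.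
Qed.

Lemma measurable_tail_term D n :
  measurable_fun D (Re \o tail_term n) /\ measurable_fun D (Im \o tail_term n).
Proof.
have dt t := is_CderiveM
  (is_Cderive_cst ((coef n)%:C * (b%:C / rate n) ^+ (k n).+1) t)
  (is_Cderive_gtail (k n) (rate n) t).
exact: Cderive_measurable dt.
Qed.

(** With t >= k/b the weight is at least exp ((p (K+3) + 1) X), which exceeds the
    p-th power of the tail by exp X; since exp X / b is unbounded in n, the
    intervals around the peaks force the integral to be infinite. *)
Lemma weighted_tail_integral (p : R) : 1 <= p ->
  (\int[mu]_(t in half_line)
     ((normc (transform 0 - Cintegral `[0%R, t] wave) `^ p
       * expR (b `^ (1 / (alpha + 1)) * (p * (K + 3) + 1) * t `^ (1 / (alpha + 1))))%R)%:E)%E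
  = +oo%E.
Proof.
move=> p1; set q := 1 / (alpha + 1); set gam := b `^ q * _.
have p0 : 0 <= p by exact: le_trans p1.
have al1 : 0 < alpha + 1 by rewrite addr_gt0.
have q0 : 0 < q by rewrite divr_gt0.
pose H t := normc (transform 0 - Cintegral `[0, t] wave) `^ p * expR (gam * t `^ q).
have H0 t : 0 <= H t by rewrite mulr_ge0 ?powR_ge0 ?expR_ge0.
have mH : measurable_fun half_line H.
  apply: measurable_funM.
    apply: (@measurableT_comp _ _ _ _ _ _ (@powR R ^~ p)); first exact: measurable_powR.
    apply: (@eq_measurable_fun _ _ _ _ half_line (normc \o (fun t => csum (tail_term ^~ t)))).
      by move=> t; rewrite inE half_lineE => t0; congr normc; apply/esym/wave_tailE.
    have [mR mI] := @measurable_csum R half_line tail_term (fun=> 1)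
      (fun n => (measurable_tail_term half_line n).1)
      (fun n => (measurable_tail_term half_line n).2)
      (fun t Dt => tail_geodom (eq_ind _ id Dt _ (half_lineE t))).
    exact: measurable_normc.
  apply: measurableT_comp; first exact: measurable_expR.
  apply: measurable_funM; first exact: measurable_cst.
  by apply: measurable_funTS; exact: measurable_powR.
have Hge n t : (k n)%:R / b <= t -> t <= (k n).+1%:R / b -> expR (X n) <= H t.
  move=> kt tk; rewrite /H.
  have kb0 : 0 <= (k n)%:R / b by rewrite divr_ge0// ltW.
  have t0 : 0 <= t by exact: le_trans kt.
  have tq : X n <= b `^ q * t `^ q.
    have -> : X n = (k n)%:R `^ q.
      by rewrite kX -powRrM mulrC mulfVK ?gt_eqF// powRr1// ltW.
    rewrite -powRM ?(ltW b0)//; apply: ge0_ler_powR;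
      rewrite ?nnegrE ?(ltW q0) ?(mulr_ge0 (ltW b0) t0)//.
    by rewrite mulrC -ler_pdivrMr.
  have np : expR (- (p * (K + 3) * X n)) <=
      normc (transform 0 - Cintegral `[0, t] wave) `^ p.
    have -> : expR (- (p * (K + 3) * X n)) = expR (- ((K + 3) * X n)) `^ p.
      by rewrite /powR gt_eqF ?expR_gt0// expRK; congr expR; ring.
    by apply: ge0_ler_powR; rewrite ?nnegrE ?expR_ge0 ?normc_ge0//; exact: tail_ge.
  apply: (@le_trans _ _ (expR (- (p * (K + 3) * X n)) * expR ((p * (K + 3) + 1) * X n))).
    by rewrite -expRD ler_expR; lra.
  apply: ler_pM; rewrite ?expR_ge0// ler_expR /gam mulrAC [leRHS]mulrC ler_wpM2l//.
  by have := K2; nra.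
have low n : ((expR (X n) / b)%:E <= \int[mu]_(t in half_line) (H t)%:E)%E.
  pose I : set R := `[(k n)%:R / b, (k n).+1%:R / b]%classic.
  have muI : mu I = (b^-1)%:E.
    rewrite /I lebesgue_measure_itv/= lte_fin ltr_pM2r ?invr_gt0// ltr_nat ltnSn.
    by rewrite -EFinB -mulrBl -natr1 addrAC subrr add0r mul1r.
  have subI : I `<=` half_line.
    move=> t; rewrite /I /= half_lineE in_itv/= => /andP[kt _].
    by apply: le_trans kt; rewrite divr_ge0// ltW.
  apply: (@le_trans _ _ (\int[mu]_(t in I) (H t)%:E)%E); last first.
    apply: ge0_subset_integral => //.
    - exact: measurable_itv.
    - exact: measurable_half_line.
    - exact/measurable_EFinP.
    - by move=> t _; rewrite lee_fin.
  apply: (@le_trans _ _ (\int[mu]_(t in I) (expR (X n))%:E)%E).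
    rewrite integral_cst; last exact: measurable_itv.
    by rewrite -[X in (_ * X)%E]/(mu I) muI -EFinM.
  apply: ge0_le_integral.
  - exact: measurable_itv.
  - by move=> t _; rewrite lee_fin expR_ge0.
  - exact: measurable_cst.
  - apply/measurable_EFinP; apply: measurable_funS mH => //.
    exact: measurable_half_line.
  - move=> t; rewrite /I /= in_itv/= => /andP[kt tk]; rewrite lee_fin.
    exact: Hge kt tk.
apply/eqyP => A A0.
have [n An] := exists_natr_ge A.
apply: le_trans (low n); rewrite lee_fin; apply: (le_trans An).
rewrite ler_pdivlMr//; apply: le_trans (eXk n).
have nk : n%:R <= (k n).+2%:R ^+ 3 :> R.
  apply: (@le_trans _ _ (k n).+2%:R).
    rewrite ler_nat; apply: leq_trans (_ : (k n <= _)%N); last exact/leqW/leqW.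
    by apply: leq_trans (k2 n); apply: ltnW; apply: leq_trans (ltn_expl n.+1 (ltnSn 1)).
  by rewrite exprS ler_peMr// expr_ge1// ler1n.
rewrite mulrC; apply: ler_pM => //; first exact: ltW.
by have := M4b; have := b1; lra.
Qed.

End Construction.

Theorem theorem5p8 (R : realType) (alpha p : R) (halpha : 0 < alpha)
    (hp : 1 <= p) :
  exists (gamma : R) (f : R -> R[i]),
    [/\ 0 < gamma,
        Lp_half_line p f &
        exists F : R[i] -> R[i],
          bounded_analytic_extension f (log_region alpha) F /\
          (\int[@lebesgue_measure R]_(t in half_line)
             ((normc (F 0 - Cintegral `[0%R, t] f) `^ p
               * expR (gamma * t `^ (1 / (alpha + 1))))%R)%:E)%E = +oo%E].
Proof.
pose b : R := 1 / ln 2 `^ alpha + 1.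
pose K : R := 4 * 2 `^ alpha + 2.
pose M : R := 4 * b + 2 * 2 `^ (1 / alpha) + 4 * (K + 3) + 4 * expR 2.
have al1 : 0 < alpha + 1 by rewrite addr_gt0.
have l2 : 0 < ln 2 `^ alpha by rewrite powR_gt0// ln_gt0// ltr1n.
have b1 : 1 <= b by rewrite /b lerDr divr_ge0// ltW.
have K2 : 2 <= K by rewrite /K lerDr mulr_ge0// powR_ge0.
have r0 : 0 <= 2 `^ (1 / alpha) :> R by exact: powR_ge0.
have e0 : 0 <= expR 2 :> R by exact: expR_ge0.
have q0 : 0 < 1 / (alpha + 1) by rewrite divr_gt0.
have q1 : 1 / (alpha + 1) < 1 by rewrite ltr_pdivrMr// mul1r ltrDr.
have M1 : 1 <= M by rewrite /M; lra.
have [k [XM XMk eXk k2 kk]] := sparse_scales q0 q1 M1.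
pose X n : R := (k n)%:R `^ (1 / (alpha + 1)).
have kX n : (k n)%:R = X n `^ (alpha + 1).
  by rewrite /X -powRrM mulfVK ?gt_eqF// powRr1.
have bln : 1 / ln 2 `^ alpha <= b - 1 by rewrite /b addrK.
have M4b : 4 * b <= M by rewrite /M; lra.
have Malpha : 2 * 2 `^ (1 / alpha) <= M by rewrite /M; lra.
have MK : 4 * (K + 3) <= M by rewrite /M; lra.
have Me : 4 * expR 2 <= M by rewrite /M; lra.
exists (b `^ (1 / (alpha + 1)) * (p * (K + 3) + 1)), (wave b K k X); split.
- rewrite mulr_gt0 ?powR_gt0 ?(lt_le_trans ltr01 b1)// ltr_wpDl// mulr_ge0 ?(le_trans ler01 hp)//.
  lra.
- by apply: (wave_Lp (alpha := alpha) (M := M)).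
- exists (transform b K k X); split; last first.
    by apply: (weighted_tail_integral (M := M)).
  split.
  + by apply: (transform_holomorphic (M := M)).
  + by exists 2 => z; apply: (transform_bounded (M := M)).
  + by move=> z z0; apply: (laplace_wave (alpha := alpha) (M := M)).
Qed.
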